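(* Fix $\epsilon<1/40$. There is a polynomial-time algorithm with the following guarantee. Let $G$ be a graph on $n$ vertices that is a $3\epsilon$-edge-expander, and let $H$ be a graph that is $\epsilon$-near $K_3\times G$. Given $H$ (and $\epsilon$), the algorithm runs in time polynomial in $n$ and outputs a proper 3-coloring of $H$.
   Context: All graphs are finite, undirected, simple and loopless. For a graph $X$ and vertex $v$, $\Gamma_X(v)$ is the neighbourhood of $v$ in $X$, and for $S\subseteq V(X)$, $\operatorname{vol}_X(S)=\sum_{v\in S}|\Gamma_X(v)|$. The tensor product $F\times G$ has vertex set $V(F)\times V(G)$, with $(f,g)$, $(f',g')$ adjacent iff $\{f,f'\}\in E(F)$ and $\{g,g'\}\in E(G)$. $K_3$ is the complete graph on $\{a,b,c\}$. Let $P=K_3\times G$. A graph $H$ is $\epsilon$-near $K_3\times G$ if there is $E'\subseteq E(P)$ such that every vertex $v$ of $P$ has at most $\epsilon|\Gamma_P(v)|$ incident edges in $E'$, and $H$ is isomorphic to $(V(P),E(P)\setminus E')$. A graph $G$ is an $\alpha$-edge-expander if for every $S\subseteq V(G)$, the number of edges of $G$ with one endpoint in $S$ and the other in $\bar S=V(G)\setminus S$ is at least $\alpha\min(\operatorname{vol}_G(S),\operatorname{vol}_G(\bar S))$. *)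

(* Defs.v *)
From mathcomp Require Import all_boot all_order all_algebra.

Set Implicit Arguments.
Unset Strict Implicit.
Unset Printing Implicit Defensive.

Import Order.TTheory GRing.Theory Num.Theory.

(** * Graphs *)

Record sgraph (T : finType) := SGraph {
  adj :> rel T;
  adj_sym : symmetric adj;
  adj_irr : irreflexive adj
}.

Definition nbhd (T : finType) (X : sgraph T) (v : T) : {set T} :=
  [set u | X v u].

Definition edges (T : finType) (X : sgraph T) : {set {set T}} :=
  [set e : {set T} | [exists u, exists v, X u v && (e == [set u; v])]].

Definition vol (T : finType) (X : sgraph T) (S : {set T}) : nat :=
  \sum_(v in S) #|nbhd X v|.

Definition cut (T : finType) (X : sgraph T) (S : {set T}) : {set {set T}} :=
  [set e in edges X | [exists u in S, exists v in ~: S, e == [set u; v]]].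

Definition edge_expander (R : realFieldType) (alpha : R)
    (T : finType) (X : sgraph T) : Prop :=
  forall S : {set T},
    (alpha * (minn (vol X S) (vol X (~: S)))%:R <= #|cut X S|%:R)%R.

Lemma complete_sym (T : finType) : symmetric (fun u v : T => u != v).
Proof. by move=> u v; rewrite eq_sym. Qed.

Lemma complete_irr (T : finType) : irreflexive (fun u v : T => u != v).
Proof. by move=> u; rewrite eqxx. Qed.

Definition complete (T : finType) : sgraph T :=
  SGraph (@complete_sym T) (@complete_irr T).

Definition K3 : sgraph 'I_3 := complete 'I_3.

Section Tensor.
Variables (T U : finType) (F : sgraph T) (G : sgraph U).

Definition tensor_rel : rel (T * U) := fun p q => F p.1 q.1 && G p.2 q.2.

Lemma tensor_sym : symmetric tensor_rel.
Proof. by move=> p q; rewrite /tensor_rel adj_sym (adj_sym G). Qed.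

Lemma tensor_irr : irreflexive tensor_rel.
Proof. by move=> p; rewrite /tensor_rel adj_irr. Qed.

Definition tensor : sgraph (T * U)%type := SGraph tensor_sym tensor_irr.
End Tensor.

Section DeleteEdges.
Variables (T : finType) (X : sgraph T) (E' : {set {set T}}).

Definition del_rel : rel T := fun u v => X u v && ([set u; v] \notin E').

Lemma del_sym : symmetric del_rel.
Proof. by move=> u v; rewrite /del_rel adj_sym setUC. Qed.

Lemma del_irr : irreflexive del_rel.
Proof. by move=> u; rewrite /del_rel adj_irr. Qed.

Definition del_edges : sgraph T := SGraph del_sym del_irr.
End DeleteEdges.

Definition isomorphic (T U : finType) (X : sgraph T) (Y : sgraph U) : Prop :=
  exists f : T -> U, bijective f /\ forall u v, X u v = Y (f u) (f v).

Definition near_K3_tensor (R : realFieldType) (eps : R)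
    (V W : finType) (G : sgraph V) (H : sgraph W) : Prop :=
  let P := tensor K3 G in
  exists E' : {set {set ('I_3 * V)}},
    [/\ E' \subset edges P,
        forall v, (#|[set e in E' | v \in e]|%:R <= eps * #|nbhd P v|%:R)%R
      & isomorphic H (del_edges P E')].

Definition proper_coloring (T : finType) (X : sgraph T) (k : nat)
    (c : T -> 'I_k) : Prop :=
  forall u v, X u v -> c u != c v.

(** * Random access machines

    Structured programs for a random access machine whose memory cells hold
    natural numbers, with indirect addressing.  Every operation has unit cost;
    since addition and truncated subtraction are the only arithmetic
    operations, a run of t steps creates no number whose bit length exceeds
    that of the input and program constants by more than t, so that polynomial
    time on this machine coincides with polynomial time on Turing machines. *)

Definition memory := nat -> nat.

Inductive expr :=
  | Const of nat
  | Read of expr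
  | Plus of expr & expr
  | Minus of expr & expr.

Fixpoint eval (s : memory) (e : expr) : nat :=
  match e with
  | Const k => k
  | Read a => s (eval s a)
  | Plus e1 e2 => eval s e1 + eval s e2
  | Minus e1 e2 => eval s e1 - eval s e2
  end.

Fixpoint ecost (e : expr) : nat :=
  match e with
  | Const _ => 1
  | Read a => (ecost a).+1
  | Plus e1 e2 | Minus e1 e2 => (ecost e1 + ecost e2).+1
  end.

Inductive cmd :=
  | Skip
  | Store of expr & expr
  | Seq of cmd & cmd
  | If of expr & cmd & cmd
  | While of expr & cmd.

(** [exec c s t s']: from memory [s], program [c] halts after exactly [t]
    steps with memory [s'].  [Store a e] writes [e] into the cell with address
    [a]; a test succeeds when its value is nonzero. *)
Inductive exec : cmd -> memory -> nat -> memory -> Prop :=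
  | ExecSkip s : exec Skip s 1 s
  | ExecStore a e s :
      exec (Store a e) s (ecost a + ecost e).+1
        [eta s with eval s a |-> eval s e]
  | ExecSeq c1 c2 s s1 s2 t1 t2 :
      exec c1 s t1 s1 -> exec c2 s1 t2 s2 ->
      exec (Seq c1 c2) s (t1 + t2) s2
  | ExecIf e c1 c2 s t s' :
      exec (if eval s e != 0 then c1 else c2) s t s' ->
      exec (If e c1 c2) s (ecost e + t).+1 s'
  | ExecWhileDone e c s :
      eval s e = 0 -> exec (While e c) s (ecost e).+1 s
  | ExecWhileStep e c s s1 s2 t1 t2 :
      eval s e != 0 -> exec c s t1 s1 -> exec (While e c) s1 t2 s2 ->
      exec (While e c) s (ecost e + t1 + t2).+1 s2.

Lemma exec_det c s t1 s1 t2 s2 :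
  exec c s t1 s1 -> exec c s t2 s2 -> t1 = t2 /\ s1 = s2.
Proof.
move=> E1; elim: E1 t2 s2 => {c s t1 s1}
  [s|a e s|c1 c2 s s1 s2 u1 u2 _ IH1 _ IH2|e c1 c2 s u s' _ IH|e c s e0
  |e c s s1 s2 u1 u2 en0 _ IH1 _ IH2] t r E2; inversion E2; subst=> //.
- match goal with h : exec c1 _ _ _ |- _ => have [? ?] := IH1 _ _ h end; subst.
  by match goal with h : exec c2 _ _ _ |- _ => have [-> ->] := IH2 _ _ h end.
- by match goal with h : exec _ _ _ _ |- _ => have [-> ->] := IH _ _ h end.
- by match goal with h : is_true (_ != 0) |- _ => rewrite e0 in h end.
- by match goal with h : eval _ _ = 0 |- _ => rewrite h in en0 end.
- match goal with h : exec c _ _ _ |- _ => have [? ?] := IH1 _ _ h end; subst.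
  by match goal with h : exec (While _ _) _ _ _ |- _ => have [-> ->] := IH2 _ _ h end.
Qed.

(** Adjacency-matrix encoding: cell 0 holds the number of vertices [m], cell
    [1 + i * m + j] holds the adjacency bit of [i] and [j], and all other
    cells are 0. *)
Definition graph_mem (m : nat) (H : sgraph 'I_m) : memory := fun k =>
  if k == 0 then m
  else [exists i : 'I_m, exists j : 'I_m, H i j && (k == (i * m + j).+1)] : nat.

(** The colour of vertex [i] is output in cell [i]. *)
Definition outputs_coloring (m k : nat) (s : memory) (c : 'I_m -> 'I_k) : Prop :=
  forall i : 'I_m, s i = c i.

Definition poly_bounded (T : nat -> nat) : Prop :=
  exists a d : nat, forall n, T n <= a * n ^ d + a.

(** The size of [graph_mem H] is polynomial in the number of vertices of [H],
    so running times may be measured against the latter. *)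
Definition poly_time (A : cmd) : Prop :=
  exists2 T : nat -> nat, poly_bounded T &
    forall (m : nat) (H : sgraph 'I_m),
      exists t s, exec A (graph_mem H) t s /\ t <= T m.

(* Main.v *)
Require Import Defs.
From mathcomp Require Import all_boot all_order all_algebra.
From mathcomp Require Import zify lra.

Set Implicit Arguments.
Unset Strict Implicit.
Unset Printing Implicit Defensive.

Import Order.TTheory GRing.Theory Num.Theory.

(* Colour the six vertices of two fibres [K3 x {v}], [K3 x {t}] (all choices of
   six vertices are tried) and propagate: a vertex [p] is forced to take the
   third colour as soon as there are [q], [r] of different colours such that
   either [p] is adjacent to both, or [p], [q], [r] look like a fibre (pairwise
   many common neighbours, no neighbour common to all three).  Both rules are
   sound for the colouring by the [K3]-coordinate, and the second one is
   satisfied by genuine fibres.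

   At the end no fibre has exactly one uncoloured vertex.  Let [A] be the set of
   the [v] whose fibre is fully coloured.  An uncoloured vertex over [u] lost an
   edge to the fibre of each neighbour of [u] in [A], so cut(A) <= 2 eps vol(~A);
   as a fibre that is not full has two uncoloured vertices, every edge of the
   cut accounts for two deleted edges at the fibres of [A], so
   2 cut(A) <= 6 eps vol(A).  Expansion then leaves two cases: cut(A) is empty,
   or there is equality in the second bound and no edge between two fibres of
   [A] was deleted.  In the second case a cut edge {v', t} has a deleted edge
   above it, so starting over from the fibres of [v] and [t] puts a deleted edge
   inside the new [A], whose cut is therefore empty.  When cut(A) is empty the
   coloured vertices form a union of connected components of [H], so that
   partial colourings obtained from different starting points can safely
   overwrite each other. *)

(** * Propagation in a graph near a tensor product *)

Lemma nbhdE (T : finType) (X : sgraph T) u v : (v \in nbhd X u) = X u v.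
Proof. by rewrite inE. Qed.

Lemma third_colour (x y : 'I_3) : exists z : 'I_3, (z != x) && (z != y).
Proof.
case: x y => [[|[|[|//]]] i] [[|[|[|//]]] j];
  first [by exists (inord 0); rewrite -!val_eqE /= inordK
        |by exists (inord 1); rewrite -!val_eqE /= inordK
        |by exists (inord 2); rewrite -!val_eqE /= inordK].
Qed.

Lemma three_colours (x y z w : 'I_3) :
  x != y -> z != x -> z != y -> w != x -> w != y -> w = z.
Proof.
move=> /eqP xy /eqP zx /eqP zy /eqP wx /eqP wy; apply: val_inj => /=.
have lt (i : 'I_3) : i < 3 by [].
have ne (i j : 'I_3) : i <> j -> i <> j :> nat by move=> ? /val_inj.
move: (lt x) (lt y) (lt z) (lt w) (ne _ _ xy) (ne _ _ zx) (ne _ _ zy)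
  (ne _ _ wx) (ne _ _ wy).
lia.
Qed.

(** Each cut edge has exactly one orientation from outside [A] to inside [A], so two-element sets
    can be counted as ordered pairs. *)
Lemma card_cut (V : finType) (G : sgraph V) (A : {set V}) :
  #|cut G A| = \sum_(u in ~: A) #|nbhd G u :&: A|.
Proof.
pose D := [set z : V * V | [&& z.1 \in ~: A, z.2 \in A & G z.1 z.2]].
have -> : cut G A = [set [set z.1; z.2] | z in D].
  apply/setP=> e; rewrite !inE; apply/andP/imsetP.
    case=> /existsP[u /existsP[v /andP[uv /eqP->]]].
    case/existsP=> s /andP[sA] /existsP[t /andP[tA] /eqP E].
    exists (t, s) => /=; last by rewrite E setUC.
    rewrite !inE /= sA -in_setC tA /=.
    have st : s != t by apply: contraTneq tA => <-; rewrite inE sA.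
    have: s \in [set u; v] by rewrite E !inE eqxx.
    have: t \in [set u; v] by rewrite E !inE eqxx orbT.
    by rewrite !inE => /orP[]/eqP Et /orP[]/eqP Es; move: st;
      rewrite Es Et ?eqxx // adj_sym.
  case=> -[t s]; rewrite !inE /= => /and3P[tA sA ts] ->; split.
    by apply/existsP; exists t; apply/existsP; exists s; rewrite ts eqxx.
  apply/existsP; exists s; rewrite sA; apply/existsP; exists t.
  by rewrite inE tA setUC /=.
rewrite card_in_imset; last first.
  move=> [t s] [t' s']; rewrite !inE /= => /and3P[tA sA _] /and3P[tA' sA' _] E.
  have: t \in [set t'; s'] by rewrite -E !inE eqxx.
  have: s \in [set t'; s'] by rewrite -E !inE eqxx orbT.
  rewrite !inE => /orP[]/eqP Es /orP[]/eqP Et.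
  - by move: sA; rewrite Es (negPf tA').
  - by move: sA; rewrite Es (negPf tA').
  - by rewrite Es Et.
  - by move: tA; rewrite Et sA'.
rewrite -sum1_card; under [RHS]eq_bigr do rewrite -sum1_card.
by rewrite pair_big_dep; apply: eq_bigl => z; rewrite !inE [G _ _ && _]andbC.
Qed.

(** * The two forcing rules *)

Section Propagation.
Variables (T : finType) (H : sgraph T).

Definition codeg p q := #|nbhd H p :&: nbhd H q|.

(** The threshold 1/3 lies below the proportion, about 1/2, of common neighbours of two vertices in
    a genuine fibre, and is still large enough to exclude vertices of equal colour. *)
Definition sibling p q r :=
  [&& 0 < #|nbhd H q|, 0 < #|nbhd H r|,
      #|nbhd H q| <= 3 * codeg p q, #|nbhd H r| <= 3 * codeg p r,
      #|nbhd H q| <= 3 * codeg q r, #|nbhd H r| <= 3 * codeg q r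
    & #|nbhd H p :&: nbhd H q :&: nbhd H r| == 0].

Definition forces p q r := H p q && H p r || sibling p q r.

Definition forcing_closed (c : T -> 'I_3) (C : {set T}) :=
  forall p q r, q \in C -> r \in C -> c q != c r -> forces p q r -> p \in C.

End Propagation.

(** * Degrees and soundness of the rules near a tensor product *)

Section NearTensor.
Variables (R : realFieldType) (eps : R).
Hypothesis heps : (eps < 1 / 40%:R)%R.
Variables (V : finType) (G : sgraph V) (T : finType) (H : sgraph T).
Variables (c : T -> 'I_3) (b : T -> V) (mk : 'I_3 -> V -> T).
Hypotheses (c_mk : forall x v, c (mk x v) = x)
           (b_mk : forall x v, b (mk x v) = v)
           (mkK : forall p, mk (c p) (b p) = p).
Hypothesis adjH : forall p q, H p q -> (c p != c q) && G (b p) (b q).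

Let d v := #|nbhd G v|.

(** A deleted edge at [p] is recorded by its other endpoint. The coordinates [c], [b], [mk] stand
    for the isomorphism with the product, where [p] has degree [2 * d (b p)]. *)
Definition deleted p : {set T} :=
  [set q | [&& c p != c q, G (b p) (b q) & ~~ H p q]].

Hypothesis few_deleted :
  forall p, (#|deleted p|%:R <= eps * (2 * d (b p))%:R)%R.

Lemma few_deleted_nat p : 20 * #|deleted p| <= d (b p).
Proof.
have e1 := few_deleted p.
have dge : (0 <= (d (b p))%:R :> R)%R by rewrite ler0n.
have e2 : (eps * (d (b p))%:R <= 1 / 40%:R * (d (b p))%:R)%R.
  by apply: ler_wpM2r => //; apply: ltW.
rewrite -(ler_nat R) natrM; rewrite natrM in e1; lra.
Qed.

Lemma deleted_sym p q : (q \in deleted p) = (p \in deleted q).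
Proof. by rewrite !inE eq_sym (adj_sym G) (adj_sym H). Qed.

Lemma card_layer x (S : {set V}) :
  #|[set q | (c q == x) && (b q \in S)]| = #|S|.
Proof.
rewrite -(card_imset S (can_inj (b_mk x))); apply: eq_card => q.
rewrite inE; apply/andP/imsetP => [[/eqP <- bq]|[v vS ->]].
  by exists (b q); rewrite ?mkK.
by rewrite c_mk b_mk.
Qed.

Lemma nbhd_le p : #|nbhd H p| <= 2 * d (b p).
Proof.
have [y /andP[yx _]] := third_colour (c p) (c p).
have [z /andP[zx zy]] := third_colour (c p) y.
have s : nbhd H p \subset [set q | (c q == y) && (b q \in nbhd G (b p))]
    :|: [set q | (c q == z) && (b q \in nbhd G (b p))].
  apply/subsetP=> q; rewrite !inE => /adjH/andP[pq ->]; rewrite !andbT.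
  have [//|qy] := eqVneq (c q) y.
  by apply/eqP; apply: (@three_colours (c p) y); rewrite // eq_sym.
by rewrite (leq_trans (subset_leq_card s)) // cardsU !card_layer mul2n -addnn
  leq_subr.
Qed.

(** The layers over [nbhd G (b p)] in the two other colours are disjoint, have size [d (b p)] each,
    and contain only neighbours of [p] and vertices of [deleted p]. *)
Lemma nbhd_ge p : 2 * d (b p) <= #|nbhd H p| + #|deleted p|.
Proof.
have [y /andP[yx _]] := third_colour (c p) (c p).
have [z /andP[zx zy]] := third_colour (c p) y.
set Y := [set q | (c q == y) && (b q \in nbhd G (b p))].
set Z := [set q | (c q == z) && (b q \in nbhd G (b p))].
have dYZ : #|Y :&: Z| = 0.
  apply/eqP; rewrite cards_eq0; apply/eqP/setP => q; rewrite !inE.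
  by case: (eqVneq (c q) z) => [->|]; rewrite ?(negPf zy) ?andbF.
have s : Y :|: Z \subset nbhd H p :|: deleted p.
  apply/subsetP=> q; rewrite !inE => /orP[] /andP[/eqP-> ->];
  by rewrite eq_sym ?yx ?zx /= orbN.
move/subset_leq_card: s; rewrite cardsU dYZ !card_layer.
by rewrite cardsU /d; lia.
Qed.

(** Two vertices of a fibre share the layer of the third colour over [nbhd G v], up to at most
    [d v / 20] deletions each. Three times the remaining [9/10 d v] exceeds the degree bound
    [2 * d v]. A neighbour common to all three would need a fourth colour. *)
Lemma sibling_fibre v x y z : 0 < d v -> x != y -> z != x -> z != y ->
  sibling H (mk x v) (mk y v) (mk z v).
Proof.
move=> dv xy zx zy.
have dl t : 20 * #|deleted (mk t v)| <= d v.
  by have:= few_deleted_nat (mk t v); rewrite b_mk.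
have ge t : 2 * d v <= #|nbhd H (mk t v)| + #|deleted (mk t v)|.
  by have:= nbhd_ge (mk t v); rewrite b_mk.
have le t : #|nbhd H (mk t v)| <= 2 * d v.
  by have:= nbhd_le (mk t v); rewrite b_mk.
have co s t : s != t ->
    d v <= codeg H (mk s v) (mk t v) + #|deleted (mk s v)| + #|deleted (mk t v)|.
  move=> st; have [w /andP[ws wt]] := third_colour s t.
  have sb : [set q | (c q == w) && (b q \in nbhd G v)] \subset
      (nbhd H (mk s v) :&: nbhd H (mk t v)) :|: deleted (mk s v)
      :|: deleted (mk t v).
    apply/subsetP=> q; rewrite !inE !c_mk !b_mk => /andP[/eqP-> ->].
    rewrite ![_ == w]eq_sym ws wt /=.
    by do 2![case: (H _ q)].
  move/subset_leq_card: sb; rewrite card_layer !cardsU /codeg /d; lia.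
have [dx dy dz] := And3 (dl x) (dl y) (dl z).
have [gy gz ly lz] := And4 (ge y) (ge z) (le y) (le z).
have cxy := co _ _ xy; have cxz : _ := co x z; rewrite eq_sym zx in cxz.
have {}cxz := cxz isT; have cyz : _ := co y z; rewrite eq_sym zy in cyz.
have {}cyz := cyz isT.
apply/and5P; split; try by lia.
apply/and3P; split; try by lia.
rewrite cards_eq0; apply/eqP/setP => q; rewrite !inE; apply/negP.
case/andP=> /andP[] /adjH/andP[+ _] /adjH/andP[+ _] /adjH/andP[+ _].
rewrite !c_mk ![_ == c q]eq_sym => qx qy.
by rewrite (three_colours xy zx zy qx qy) eqxx.
Qed.

(* [N p] and [N q] would take up disjoint thirds of [N r] inside a single
   colour layer, that is, inside about one half of [N r]. *)
Lemma sibling_same_colour p q r : c p = c q -> c q != c r ->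
  #|nbhd H r| <= 3 * codeg H p r -> #|nbhd H r| <= 3 * codeg H q r ->
  #|nbhd H p :&: nbhd H q :&: nbhd H r| = 0 -> #|nbhd H r| = 0.
Proof.
move=> pq qr hp hq h0.
have [z /andP[zq zr]] := third_colour (c q) (c r).
have s : (nbhd H p :&: nbhd H r) :|: (nbhd H q :&: nbhd H r) \subset
    [set w | (c w == z) && (b w \in nbhd G (b r))].
  have in_layer w : w \in nbhd H q :|: nbhd H p -> w \in nbhd H r ->
      (c w == z) && G (b r) (b w).
    rewrite !inE => hw /adjH/andP[rw ->]; rewrite andbT.
    have qw : c w != c q.
      by rewrite eq_sym; case/orP: hw => /adjH/andP[]; rewrite ?pq.
    by apply/eqP/(three_colours qr); rewrite // eq_sym.
  apply/subsetP=> w; rewrite 2!inE => /orP[]/setIP[wp wr];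
  by rewrite !inE (in_layer w) // inE wp ?orbT.
move/subset_leq_card: s; rewrite card_layer cardsU.
rewrite setIACA setIid h0 subn0 -/(codeg H p r) -/(codeg H q r) -/(d _) => e.
have:= few_deleted_nat r; have:= nbhd_ge r; have:= nbhd_le r; lia.
Qed.

(** For the sibling rule, [sibling_same_colour] is applied twice, with [q] and [r] exchanged the
    second time. *)
Lemma forces_colour p q r :
  c q != c r -> forces H p q r -> (c p != c q) && (c p != c r).
Proof.
move=> qr /orP[/andP[/adjH/andP[-> _] /adjH/andP[-> _]] //|].
case/and5P=> q0 r0 pq pr /and3P[qrq qrr /eqP h0]; apply/andP; split.
  by apply: contraTneq r0 => E; rewrite (@sibling_same_colour p q r).
apply: contraTneq q0 => E; rewrite (@sibling_same_colour p r q) //.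
- by rewrite eq_sym.
- by rewrite /codeg setIC.
- by rewrite setIAC.
Qed.

(** * Counting deleted edges around a closed set *)

Section Closed.
Variable C : {set T}.
Hypothesis closedC : forcing_closed H c C.

Definition full : {set V} := [set v | [forall x, mk x v \in C]].

Lemma full_mk v x : v \in full -> mk x v \in C.
Proof. by rewrite inE => /forallP. Qed.

(** A single missing vertex would be forced by the other two vertices of its fibre through the
    sibling rule. *)
Lemma two_missing v : 0 < d v -> v \notin full ->
  exists x y, [/\ x != y, mk x v \notin C & mk y v \notin C].
Proof.
move=> dv; rewrite inE negb_forall => /existsP[x xC].
have [y /andP[yx _]] := third_colour x x.
have [z /andP[zx zy]] := third_colour x y.
have [yC|yC] := boolP (mk y v \in C); last first.
  by exists x, y; split; rewrite // eq_sym.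
have [zC|zC] := boolP (mk z v \in C); last first.
  by exists x, z; split; rewrite // eq_sym.
case/negP: xC; apply: (closedC yC zC); rewrite ?c_mk 1?eq_sym //.
by apply/orP; right; apply: sibling_fibre; rewrite // eq_sym.
Qed.

(** If [p] had neighbours over [full] in both other colours, it would be forced. Hence one colour
    [y], the same for all [v], is absent among these neighbours. *)
Lemma missing_deleted p : p \notin C ->
  exists y, forall v, v \in full -> G (b p) v -> mk y v \in deleted p.
Proof.
move=> pC; pose seen y := [exists v, (v \in full) && H p (mk y v)].
have [y /andP[yx _]] := third_colour (c p) (c p).
have [z /andP[zx zy]] := third_colour (c p) y.
have unseen x : x != c p -> ~~ seen x -> exists x, forall v, v \in full ->
    G (b p) v -> mk x v \in deleted p.
  move=> xp; rewrite negb_exists => /forallP nx; exists x => v vA pv.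
  by have:= nx v; rewrite vA inE c_mk b_mk eq_sym xp pv /=.
have [/existsP[v /andP[vA pv]]|/unseen] := boolP (seen y); last exact.
have [/existsP[w /andP[wA pw]]|/unseen] := boolP (seen z); last exact.
case/negP: pC; apply: (closedC (full_mk y vA) (full_mk z wA)).
  by rewrite !c_mk eq_sym.
by rewrite /forces pv pw.
Qed.

Definition over (A : {set V}) : {set T} := [set p | b p \in A].

Lemma missing_pays x u : mk x u \notin C ->
  #|nbhd G u :&: full| <= #|deleted (mk x u) :&: over full|.
Proof.
case/missing_deleted=> y; rewrite b_mk => hy.
rewrite -(card_imset _ (can_inj (b_mk y))); apply: subset_leq_card.
apply/subsetP=> _ /imsetP[v /setIP[uv vA] ->].
by rewrite in_setI [_ \in over _]inE b_mk vA hy // -nbhdE.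
Qed.

Lemma sum_over (A : {set V}) (F : T -> nat) :
  \sum_(p in over A) F p = \sum_(u in A) \sum_x F (mk x u).
Proof.
rewrite pair_big_dep /= (reindex (fun z : V * 'I_3 => mk z.2 z.1)) /=.
  by apply: eq_bigl => z; rewrite inE b_mk andbT.
exists (fun p => (b p, c p)) => [[u x] _|p _] /=; rewrite ?mkK //.
by rewrite b_mk c_mk.
Qed.

(** At each [u] outside [full], the deletions at one missing vertex already account for all cut
    edges at [u]. *)
Lemma cut_outside :
  (#|cut G full|%:R <= eps * (2 * vol G (~: full))%:R)%R.
Proof.
rewrite card_cut /vol natr_sum natrM natr_sum mulrA mulr_sumr.
apply: ler_sum => u; rewrite inE => uA.
have [x xC] : exists x, mk x u \notin C.
  by move: uA; rewrite inE negb_forall => /existsP.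
have := few_deleted (mk x u); rewrite b_mk natrM mulrA; apply: le_trans.
rewrite ler_nat (leq_trans (missing_pays xC)) //.
exact/subset_leq_card/subsetIl.
Qed.

(** Deleted edges between [over full] and its complement are counted from the outside, where two
    missing vertices per fibre pay for each cut edge twice. Deletions internal to [over full] are
    kept as a separate term, since [full_dichotomy] needs them to vanish. *)
Lemma cut_inside :
  2 * #|cut G full| + \sum_(p in over full) #|deleted p :&: over full|
    <= \sum_(p in over full) #|deleted p|.
Proof.
have -> : \sum_(p in over full) #|deleted p| =
    \sum_(p in over full) #|deleted p :\: over full|
    + \sum_(p in over full) #|deleted p :&: over full|.
  by rewrite -big_split; apply: eq_bigr => p _; rewrite /= addnC cardsID.
rewrite leq_add2r.
(* Double counting, by symmetry of [deleted]. *)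
have -> : \sum_(p in over full) #|deleted p :\: over full| =
    \sum_(p in over (~: full)) #|deleted p :&: over full|.
  transitivity (\sum_(p in over full) \sum_(q in over (~: full))
      (q \in deleted p : nat)).
    apply: eq_bigr => p _; rewrite -sum1_card big_mkcond [RHS]big_mkcond.
    by apply: eq_bigr => q _; rewrite in_setD ![_ \in over _]inE in_setC; case: (b q \in _).
  rewrite exchange_big; apply: eq_bigr => p _.
  rewrite -sum1_card big_mkcond [RHS]big_mkcond; apply: eq_bigr => q _.
  by rewrite in_setI -deleted_sym; case: (q \in over _); case: (_ \in deleted _).
rewrite sum_over card_cut big_distrr; apply: leq_sum => u.
rewrite inE => uA.
(* An isolated [u] escapes [two_missing], but contributes nothing to the cut. *)
have [/eqP d0|dv] := posnP (d u).
  by rewrite cards_eq0 in d0; rewrite (eqP d0) set0I cards0.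
have [x [y [xy xC yC]]] := two_missing dv uA.
rewrite (bigD1 x) // (bigD1 y) 1?eq_sym //= mul2n -addnn.
by rewrite leq_add ?missing_pays // (leq_trans (missing_pays yC)) ?leq_addr.
Qed.

Hypothesis expG : edge_expander (3%:R * eps)%R G.

(** Expansion is applied to the side of smaller volume. Outside, the factor 3 against the 2 of
    [cut_outside] leaves an empty cut. Inside, twice the expansion bound already exhausts the
    [6 eps vol] of [cut_inside], so the term for internal deletions is zero. *)
Lemma full_dichotomy :
  (forall u v, u \in full -> G u v -> v \in full) \/
  (forall p q, b p \in full -> b q \in full -> q \notin deleted p).
Proof.
have cut0 : #|cut G full| = 0 -> forall u v, u \in full -> G u v -> v \in full.
  move=> c0 u v uA uv; apply: contra_eqT c0 => vA; rewrite card_cut.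
  rewrite (bigD1 v) ?in_setC ?vA //= -lt0n addn_gt0 card_gt0; apply/orP; left.
  by apply/set0Pn; exists u; rewrite in_setI nbhdE adj_sym uv.
have := expG full; have := cut_outside.
have := cut_inside; set D := \sum_(p in over full) #|deleted p|.
set I := \sum_(p in over full) _.
rewrite natrM => ins out ex.
(* Three colours, each with product degree [2 * d u]. *)
have Dle : (D%:R <= eps * 6%:R * (vol G full)%:R)%R.
  rewrite /D sum_over /vol !natr_sum mulr_sumr; apply: ler_sum => u _.
  rewrite natr_sum (@le_trans _ _ (\sum_(x < 3) (eps * (2 * d u)%:R))%R) //.
    by apply: ler_sum => x _; have:= few_deleted (mk x u); rewrite b_mk.
  by rewrite sumr_const card_ord -/(d u) natrM -[(_ *+ 3)%R]mulr_natr; lra.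
have [le|lt] := leqP (vol G (~: full)) (vol G full).
  left; apply: cut0; apply/eqP; rewrite (minn_idPr le) in ex.
  have c0 : (0 <= #|cut G full|%:R :> R)%R by rewrite ler0n.
  rewrite -(eqr_nat R); apply/eqP/le_anti/andP; split=> //.
  have v0 : (0 <= (vol G (~: full))%:R :> R)%R by rewrite ler0n.
  (* The sign of [eps] is not given; for [eps <= 0] the upper bound alone makes the cut empty. *)
  have [e0|e0] := lerP eps 0%R.
    have := mulr_le0_ge0 e0 v0; lra.
  have := mulr_ge0 (ltW e0) v0; lra.
right=> p q pA qA; rewrite (minn_idPl (ltnW lt)) in ex.
have I0 : I = 0.
  apply/eqP; rewrite -leqn0 -(ler_nat R).
  move: ins; rewrite -(ler_nat R) natrD natrM; lra.
move/eqP: I0; rewrite sum_nat_eq0 => /forallP /(_ p); rewrite inE pA /=.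
by rewrite cards_eq0 => /eqP/setP/(_ q); rewrite in_setI [_ \in over _]inE qA andbT in_set0 => ->.
Qed.

End Closed.

(** * Closures generated by two fibres *)

Definition seeds v t : {set T} := [set p | (b p == v) || (b p == t)].

Definition least_closed (S C : {set T}) :=
  [/\ forcing_closed H c C, S \subset C &
      forall C', forcing_closed H c C' -> S \subset C' -> C \subset C'].

Hypothesis expG : edge_expander (3%:R * eps)%R G.

(** A forced vertex is joined to [q] by an edge, or by a path of length two through a common
    neighbour, so forcing never leaves a union of components. *)
Lemma over_closed (A : {set V}) : (forall u v, u \in A -> G u v -> v \in A) ->
  forcing_closed H c (over A).
Proof.
move=> hA p q r; rewrite !inE => qA rA _.
have step s w : H s w -> b s \in A -> b w \in A.
  by move=> /adjH/andP[_ sw] /hA; apply.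
case/orP=> [/andP[pq _]|/and5P[q0 _ pq _ _]].
  by apply: step qA; rewrite adj_sym pq.
have: 0 < codeg H p q by rewrite -(@ltn_pmul2l 3) // muln0 (leq_trans q0).
rewrite card_gt0 => /set0Pn[w /setIP[]]; rewrite !nbhdE => pw qw.
by apply: (@step w); [rewrite adj_sym | apply: step qA].
Qed.

(** By [over_closed] and minimality, [C] lies over [full C]: no partially coloured fibre remains. *)
Lemma least_saturated v t C : least_closed (seeds v t) C ->
  (forall u w, u \in full C -> G u w -> w \in full C) ->
  forall p q, p \in C -> H p q -> q \in C.
Proof.
move=> [_ sC leastC] hA p q pC /adjH/andP[_ pq].
have sub : C \subset over (full C).
  apply: leastC; first exact: over_closed.
  apply/subsetP=> s; rewrite !inE => bs; apply/forallP => x.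
  by apply: (subsetP sC); rewrite inE b_mk.
have/hA/(_ pq) : b p \in full C by move/subsetP/(_ p pC): sub; rewrite inE.
by move/(full_mk (c q)); rewrite mkK.
Qed.

Lemma full_seeds v t (C : {set T}) : seeds v t \subset C -> (v \in full C) && (t \in full C).
Proof.
by move=> /subsetP sC; rewrite !inE; apply/andP; split; apply/forallP => x;
  apply: sC; rewrite inE b_mk eqxx ?orbT.
Qed.

(** Take [t = v] if the closure [C1] of one fibre is saturated, and otherwise the outer end of a cut
    edge [{u, t}]. A missing vertex over [t] then has a deleted edge to the fibre of [u]. Both
    fibres are full in the new closure, which rules out the second alternative of
    [full_dichotomy]. *)
Lemma saturating_seeds v : exists t, forall C, least_closed (seeds v t) C ->
  forall p q, p \in C -> H p q -> q \in C.
Proof.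
(* A boolean form of closedness, so that [C1] can be defined as an intersection over all closed
   supersets of the seeds. *)
pose closedb (C : {set T}) := [forall p, forall q in C, forall r in C,
  (c q != c r) ==> forces H p q r ==> (p \in C)].
have closedP C : reflect (forcing_closed H c C) (closedb C).
  apply: (iffP forallP) => [h p q r qC rC qr f|h p].
    by move: (h p) => /'forall_in_forall_inP/(_ q qC r rC); rewrite qr f.
  apply/forall_inP=> q qC; apply/forall_inP=> r rC; apply/implyP=> qr.
  by apply/implyP=> f; apply: h qC rC qr f.
pose C1 := \bigcap_(C : {set T} | closedb C && (seeds v v \subset C)) C.
have min1 C : forcing_closed H c C -> seeds v v \subset C -> C1 \subset C.
  by move=> /closedP h s; apply: bigcap_inf; rewrite h.
have closed1 : forcing_closed H c C1.
  move=> p q r /bigcapP qC /bigcapP rC qr f; apply/bigcapP => C hC.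
  by case/andP: (hC) => /closedP h _; apply: h (qC _ hC) (rC _ hC) qr f.
have seeds1 : seeds v v \subset C1 by apply/bigcapsP=> C /andP[].
have [sat|] := boolP [forall u in full C1, forall w, G u w ==> (w \in full C1)].
  exists v => C [clC sC minC].
  have EC : C = C1.
    by apply/eqP; rewrite eqEsubset (minC _ closed1 seeds1) (min1 _ clC sC).
  apply: (@least_saturated v v) => // u w; rewrite EC => uA uw.
  by move/forall_inP/(_ u uA)/forallP/(_ w)/implyP: sat; apply.
rewrite negb_forall => /existsP[u]; rewrite negb_imply => /andP[uA].
rewrite negb_forall => /existsP[t]; rewrite negb_imply => /andP[ut tA].
exists t => C lC; have [clC sC _] := lC.
have C1C : C1 \subset C.
  apply: min1 => //; apply: subset_trans sC; apply/subsetP=> p.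
  by rewrite !inE orbb => ->.
apply: least_saturated (lC) _.
have [//|none] := full_dichotomy clC expG.
have [x xC] : exists x, mk x t \notin C1.
  by move: tA; rewrite inE negb_forall => /existsP.
have [y hy] := missing_deleted closed1 xC.
have := hy u uA; rewrite b_mk adj_sym => /(_ ut).
rewrite (negPf (none _ _ _ _)) // b_mk; first by case/andP: (full_seeds sC).
rewrite inE; apply/forallP => z; apply: (subsetP C1C).
exact: full_mk.
Qed.

End NearTensor.

(** * The colouring algorithm *)

Section Folds.
Variables (X I : Type) (F : I -> X -> X).

Lemma foldl_inv (J : X -> Prop) s x :
  (forall i y, J y -> J (F i y)) -> J x -> J (foldl (fun y i => F i y) x s).
Proof. by move=> hF; elim: s x => //= i s IH x /(hF i)/IH. Qed.

End Folds.

(** Exhaustive search: one good iteration establishes [J], and the later ones preserve it. *)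
Lemma foldl_reach (X : Type) (T : finType) (F : T -> X -> X) (J : X -> Prop)
    (i : T) x : (forall j y, J y -> J (F j y)) -> (forall y, J (F i y)) ->
  J (foldl (fun y j => F j y) x (enum T)).
Proof.
move=> hF hi; have: i \in enum T by rewrite mem_enum.
elim: (enum T) x => //= j s IH x; rewrite inE => /orP[/eqP<-|/IH]; last exact.
exact: foldl_inv.
Qed.

Definition assign (T : finType) (f : {ffun T -> nat}) p n : {ffun T -> nat} :=
  [ffun x => if x == p then n else f x].

Lemma foldl_assign (T : finType) (E : T -> nat -> nat) (f : {ffun T -> nat}) s :
  uniq s -> foldl (fun f p => assign f p (E p (f p))) f s =
    [ffun p => if p \in s then E p (f p) else f p].
Proof.
elim: s f => [|i s IH] f /= => [_|/andP[is_ us]].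
  by apply/ffunP => p; rewrite ffunE.
rewrite IH //; apply/ffunP=> p; rewrite !ffunE inE.
by have [->|] := eqVneq p i; rewrite ?(negPf is_).
Qed.

Section Algorithm.
Variables (T : finType) (H : sgraph T).
Notation colours := {ffun T -> nat}.
Implicit Types f o : colours.

(* [0] stands for an uncoloured vertex; the third colour is written
   [1 + (5 - f q - f r)] rather than [6 - f q - f r] so that it is never [0],
   whatever the values of [f]. *)
Definition step p q r f : colours :=
  if [&& f p == 0, f q != 0, f r != 0, f q != f r & forces H p q r]
  then assign f p (5 - f q - f r).+1 else f.

Definition sweep f := foldl (fun f p => foldl (fun f q =>
  foldl (fun f r => step p q r f) f (enum T)) f (enum T)) f (enum T).

Definition propagate f := foldl (fun f _ => sweep f) f (enum T).

Definition seed p1 p2 p3 q1 q2 q3 : colours :=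
  foldl (fun f z => assign f z.1 z.2) [ffun=> 0]
    [:: (p1, 1); (p2, 2); (p3, 3); (q1, 1); (q2, 2); (q3, 3)].

Definition consistent f := [forall p, forall q,
  H p q && (f p != 0) ==> (f q != 0) && (f p != f q)].

(** The region of a consistent [f] is closed under adjacency, so overwriting [o] there is harmless
    even if the seeds were not genuine fibres. Colours 1, 2, 3 become 0, 1, 2. *)
Definition commit f o : colours :=
  if consistent f then [ffun p => if f p != 0 then (f p).-1 else o p] else o.

Definition solve : colours :=
  foldl (fun o p1 => foldl (fun o p2 => foldl (fun o p3 =>
  foldl (fun o q1 => foldl (fun o q2 => foldl (fun o q3 =>
    commit (propagate (seed p1 p2 p3 q1 q2 q3)) o)
  o (enum T)) o (enum T)) o (enum T)) o (enum T)) o (enum T)) [ffun=> 0] (enum T).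

Definition coloured f : {set T} := [set p | f p != 0].

(** The number of coloured vertices measures progress; a round without progress changes nothing. *)
Definition inflationary (F : colours -> colours) := forall f,
  #|coloured f| <= #|coloured (F f)| /\
  (#|coloured (F f)| = #|coloured f| -> F f = f).

Lemma foldl_inflationary (I : eqType) (F : I -> colours -> colours) s :
  (forall i, inflationary (F i)) ->
  inflationary (fun f => foldl (fun f i => F i f) f s) /\
  (forall f, foldl (fun f i => F i f) f s = f -> forall i, i \in s -> F i f = f).
Proof.
move=> hF; elim: s => [|j s [IHs IHf]]; first by split.
have fix_j f : #|coloured (foldl (fun f i => F i f) (F j f) s)| = #|coloured f| ->
    F j f = f.
  move=> E; have [le eq] := hF j f; apply: eq; apply/eqP.
  by rewrite eqn_leq le -E (IHs (F j f)).1.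
split=> [f|f E i] /=.
  split=> [|E]; first exact: leq_trans (hF j f).1 (IHs _).1.
  by move: (E); rewrite (fix_j f E) => /(IHs f).2.
have Ej : F j f = f by apply: fix_j; rewrite [foldl _ _ _]E.
rewrite inE => /orP[/eqP-> //|]; apply: IHf.
by move: E; rewrite /= Ej.
Qed.

Lemma coloured_assign f p n : coloured (assign f p n.+1) = p |: coloured f.
Proof. by apply/setP=> q; rewrite !inE ffunE; case: (eqVneq q p). Qed.

Lemma step_inflationary p q r : inflationary (step p q r).
Proof.
move=> f; rewrite /step; case: ifP => // /and5P[p0 _ _ _ _].
rewrite coloured_assign cardsU1 inE p0 /=; split; first exact: leq_addl.
by move/eqP; rewrite -[X in _ == X]add0n eqn_add2r.
Qed.

Lemma sweep_inflationary :
  inflationary sweep /\ forall f, sweep f = f -> forall p q r, step p q r f = f.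
Proof.
have r_infl p q := foldl_inflationary (enum T) (step_inflationary p q).
have q_infl p := foldl_inflationary (enum T) (fun q => (r_infl p q).1).
have p_infl := foldl_inflationary (enum T) (fun p => (q_infl p).1).
split=> [|f Ef p q r]; first exact: p_infl.1.
have := p_infl.2 f Ef p; rewrite mem_enum => /(_ isT) Ep.
have := (q_infl p).2 f Ep q; rewrite mem_enum => /(_ isT) Eq.
by have := (r_infl p q).2 f Eq r; rewrite mem_enum => /(_ isT).
Qed.

(** Every sweep before stabilisation colours a new vertex, so [#|T|] sweeps suffice. *)
Lemma propagate_fixed f p q r : step p q r (propagate f) = propagate f.
Proof.
have [infl fixd] := sweep_inflationary; apply: fixd.
have iterE s g : let g' := foldl (fun f (_ : T) => sweep f) g s in
    sweep g' = g' \/ #|coloured g| + size s <= #|coloured g'|.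
  elim: s g => [|i s IH] g /=; first by right; rewrite addn0.
  have [le eq] := infl g; have [/eq E|ne] := eqVneq #|coloured (sweep g)| #|coloured g|.
    by left; rewrite E; elim: s {IH} => //= _ s; rewrite E.
  have [->|le'] := IH (sweep g); [by left | right; apply: leq_trans le'].
  by rewrite addnS -addSn leq_add2r ltn_neqAle eq_sym ne.
have [//|] := iterE (enum T) f; rewrite -/(propagate f) -cardE => le.
(* In the remaining case every vertex is coloured, and a further sweep cannot increase the count. *)
apply: (infl _).2; apply/eqP; rewrite eqn_leq (infl _).1 andbT.
by rewrite (leq_trans (max_card _)) // (leq_trans _ le) ?leq_addl.
Qed.

Lemma propagate_inv (J : colours -> Prop) f :
  (forall p q r g, J g -> J (step p q r g)) -> J f -> J (propagate f).
Proof.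
move=> hJ Jf; apply: foldl_inv Jf => _ g; rewrite /sweep; apply: foldl_inv => p.
by move=> {}g; apply: foldl_inv => q {}g; apply: foldl_inv => r {}g; apply: hJ.
Qed.

(** Two distinct nonzero colours sum to at least 3, hence the new one is at most [(5 - 3).+1]. *)
Lemma step_le3 p q r f : (forall x, f x <= 3) -> forall x, step p q r f x <= 3.
Proof.
move=> le3 x; rewrite /step; case: ifP => // /and5P[_ q0 r0 qr _].
by rewrite ffunE; case: ifP => // _; move/eqP: qr; lia.
Qed.

Lemma solve_inv (J : colours -> Prop) :
  (forall p1 p2 p3 q1 q2 q3 o,
    J o -> J (commit (propagate (seed p1 p2 p3 q1 q2 q3)) o)) ->
  J [ffun=> 0] -> J solve.
Proof. by move=> hJ; do 6![apply: foldl_inv => ? ?]; apply: hJ. Qed.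

Lemma solve_lt3 p : solve p < 3.
Proof.
move: p; apply: (@solve_inv (fun o => forall p, o p < 3)) => [|p]; last by rewrite ffunE.
move=> p1 p2 p3 q1 q2 q3 o lt3 p; rewrite /commit; case: ifP => // _.
rewrite ffunE; case: ifP => // p0.
suff: propagate (seed p1 p2 p3 q1 q2 q3) p <= 3 by move: p0; case: (propagate _ _).
move: p {p0}; apply: (@propagate_inv (fun f => forall p, f p <= 3)).
  exact: step_le3.
by move=> p; rewrite /= !ffunE; do 6?[case: ifP => // _].
Qed.

Definition proper_at p o := forall q, H p q -> o p <> o q.

Lemma commit_proper p f o : proper_at p o \/ consistent f /\ f p != 0 ->
  proper_at p (commit f o).
Proof.
rewrite /commit; case: ifP => [cons hp|_ [//|[//]]] q pq.
have cons' x y : H x y -> f x != 0 -> (f y != 0) && (f x != f y).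
  by move=> xy x0; have /forallP/(_ x)/forallP/(_ y) := cons; rewrite xy x0.
rewrite !ffunE; have [p0|p0] := eqVneq (f p) 0; last first.
  have /andP[q0 ne] := cons' _ _ pq p0; rewrite q0 /=.
  by move: p0 q0 ne; lia.
have [q0|q0] := eqVneq (f q) 0; last by have := cons' q p; rewrite adj_sym p0 pq => /(_ isT q0).
by case: hp => [|[]]; [apply | rewrite p0].
Qed.

(** The attempt with these six seeds makes the colouring proper at [p], and by [commit_proper] no
    later attempt spoils it. *)
Lemma solve_proper p p1 p2 p3 q1 q2 q3 :
  consistent (propagate (seed p1 p2 p3 q1 q2 q3)) ->
  propagate (seed p1 p2 p3 q1 q2 q3) p != 0 -> proper_at p solve.
Proof.
move=> cons p0; have pres f o : proper_at p o -> proper_at p (commit f o).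
  by move=> h; apply: commit_proper; left.
apply: (foldl_reach (i := p1)) => [? ?|?]; first by do 5![apply: foldl_inv => ? ?]; apply: pres.
apply: (foldl_reach (i := p2)) => [? ?|?]; first by do 4![apply: foldl_inv => ? ?]; apply: pres.
apply: (foldl_reach (i := p3)) => [? ?|?]; first by do 3![apply: foldl_inv => ? ?]; apply: pres.
apply: (foldl_reach (i := q1)) => [? ?|?]; first by do 2![apply: foldl_inv => ? ?]; apply: pres.
apply: (foldl_reach (i := q2)) => [? ?|?]; first by apply: foldl_inv => ? ?; apply: pres.
apply: (foldl_reach (i := q3)) => [? ?|?]; first by apply: pres.
by apply: commit_proper; right.
Qed.

End Algorithm.

(** * Correctness of the algorithm near a tensor product of an expander *)

Section Correctness.
Variables (R : realFieldType) (eps : R).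
Hypothesis heps : (eps < 1 / 40%:R)%R.
Variables (V : finType) (G : sgraph V) (T : finType) (H : sgraph T).
Variables (c : T -> 'I_3) (b : T -> V) (mk : 'I_3 -> V -> T).
Hypotheses (c_mk : forall x v, c (mk x v) = x)
           (b_mk : forall x v, b (mk x v) = v)
           (mkK : forall p, mk (c p) (b p) = p).
Hypothesis adjH : forall p q, H p q -> (c p != c q) && G (b p) (b q).
Hypothesis few_deleted : forall p,
  (#|deleted G H c b p|%:R <= eps * (2 * #|nbhd G (b p)|)%:R)%R.
Hypothesis expG : edge_expander (3%:R * eps)%R G.

Definition fibre_seed v t :=
  seed (mk (inord 0) v) (mk (inord 1) v) (mk (inord 2) v)
       (mk (inord 0) t) (mk (inord 1) t) (mk (inord 2) t).

Lemma fibre_seedE v t p :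
  fibre_seed v t p = if p \in seeds b v t then (c p).+1 else 0.
Proof.
have E x w : (p == mk x w) = (c p == x) && (b p == w).
  by apply/eqP/andP => [->|[/eqP<- /eqP<-]]; rewrite ?c_mk ?b_mk.
rewrite inE /= !ffunE /= !E -!val_eqE /= !inordK //.
have := ltn_ord (c p); case: (val (c p)) => [|[|[|//]]] _ /=;
  by case: (b p == t); case: (b p == v).
Qed.

(** One invariant serves two purposes: [C := setT] gives correct colours, an arbitrary closed [C]
    gives minimality. *)
Lemma fibre_seed_sound v t (C : {set T}) : forcing_closed H c C ->
  seeds b v t \subset C -> forall p, let f := propagate H (fibre_seed v t) in
  f p != 0 -> f p = (c p).+1 /\ p \in C.
Proof.
move=> clC /subsetP sC; apply: (@propagate_inv _ _
  (fun f => forall p, f p != 0 -> f p = (c p).+1 /\ p \in C)) => [p q r f hf x|p].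
  rewrite /step; case: ifP => [|_]; last exact: hf.
  case/and5P=> _ q0 r0 qr pqr; rewrite ffunE; have [-> _|_] := eqVneq x p; last exact: hf.
  have [[fq qC] [fr rC]] := (hf q q0, hf r r0); move: qr; rewrite fq fr eqSS => qr.
  split; last exact: clC qC rC qr pqr.
  have /andP[] := forces_colour heps c_mk b_mk mkK adjH few_deleted qr pqr.
  move: qr; rewrite -!val_eqE /=; have := ltn_ord (c p).
  have := ltn_ord (c q); have := ltn_ord (c r); lia.
by rewrite fibre_seedE; case: ifP => // /sC.
Qed.

Lemma fibre_seed_colour v t p : let f := propagate H (fibre_seed v t) in
  f p != 0 -> f p = (c p).+1.
Proof.
by move=> f /(fibre_seed_sound (C := setT)) []; rewrite ?subsetT // => ? *; rewrite inE.
Qed.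

Lemma fibre_seed_least v t :
  least_closed H c (seeds b v t) (coloured (propagate H (fibre_seed v t))).
Proof.
set f := propagate _ _; split.
- move=> p q r; rewrite !inE => q0 r0 qr pqr; apply/negP => /eqP p0.
  have := propagate_fixed H (fibre_seed v t) p q r; rewrite -/f => /ffunP/(_ p).
  rewrite /step p0 q0 r0 pqr (fibre_seed_colour q0) (fibre_seed_colour r0) eqSS qr.
  by rewrite /= ffunE eqxx.
- apply: (@propagate_inv _ _ (fun g => seeds b v t \subset coloured g)).
    move=> p q r g sg; rewrite /step; case: ifP => // _.
    by rewrite coloured_assign (subset_trans sg) // subsetUr.
  by apply/subsetP=> p ps; rewrite inE fibre_seedE ps.
- move=> C clC sC; apply/subsetP=> p; rewrite inE => p0.
  by have [] := fibre_seed_sound clC sC p0.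
Qed.

(** The good attempt for [p] starts from its own fibre and the one supplied by
    [saturating_seeds]. *)
Lemma solve_correct p q : H p q -> solve H p != solve H q.
Proof.
have [t sat] := saturating_seeds heps c_mk b_mk mkK adjH few_deleted expG (b p).
have {}sat := sat _ (fibre_seed_least (b p) t).
set f := propagate H (fibre_seed (b p) t) in sat.
have p0 : f p != 0.
  have [_ /subsetP/(_ p)] := fibre_seed_least (b p) t.
  by rewrite !inE eqxx => /(_ isT).
have cons : consistent H f.
  apply/forallP=> x; apply/forallP=> y; apply/implyP=> /andP[xy x0].
  have y0 : f y != 0 by have := sat x y; rewrite !inE => /(_ x0 xy).
  rewrite y0 (fibre_seed_colour x0) (fibre_seed_colour y0) eqSS.
  by have /andP[] := adjH xy.
by move=> pq; apply/eqP; apply: (solve_proper cons p0).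
Qed.

End Correctness.

(** * For-loop programs on a random access machine *)

(** A total-correctness triple with a time bound, for one initial memory. *)
Definition runs (c : cmd) (s : memory) (T : nat) (Q : memory -> Prop) :=
  exists t s', [/\ exec c s t s', t <= T & Q s'].

Lemma runs_weaken c s T T' (Q Q' : memory -> Prop) :
  T <= T' -> (forall s', Q s' -> Q' s') -> runs c s T Q -> runs c s T' Q'.
Proof.
move=> TT QQ [t [s' [e tT q]]]; exists t, s'.
by split; [| apply: leq_trans TT | apply: QQ].
Qed.

Lemma runs_store a e s (Q : memory -> Prop) :
  Q [eta s with eval s a |-> eval s e] ->
  runs (Store a e) s (ecost a + ecost e).+1 Q.
Proof. by move=> q; do 2!eexists; split; [apply: ExecStore | |]. Qed.

Lemma runs_seq c1 c2 s T1 T2 (Q1 Q : memory -> Prop) :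
  runs c1 s T1 Q1 -> (forall s1, Q1 s1 -> runs c2 s1 T2 Q) ->
  runs (Seq c1 c2) s (T1 + T2) Q.
Proof.
move=> [t1 [s1 [e1 le1 q1]]] /(_ s1 q1) [t2 [s2 [e2 le2 q2]]].
by exists (t1 + t2), s2; split; [apply: ExecSeq e1 e2 | apply: leq_add |].
Qed.

Lemma runs_store_seq a e c s T (Q : memory -> Prop) :
  runs c [eta s with eval s a |-> eval s e] T Q ->
  runs (Seq (Store a e) c) s ((ecost a + ecost e).+1 + T) Q.
Proof.
move=> h; apply: (runs_seq (Q1 := eq ([eta s with eval s a |-> eval s e] : memory))).
  exact: runs_store.
by move=> _ <-.
Qed.

Lemma runs_if e c1 c2 s T (Q : memory -> Prop) :
  runs (if eval s e != 0 then c1 else c2) s T Q ->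
  runs (If e c1 c2) s (ecost e + T).+1 Q.
Proof.
move=> [t [s' [e1 le1 q]]]; exists (ecost e + t).+1, s'.
by split; [apply: ExecIf | rewrite ltnS leq_add2l |].
Qed.

(** The index of [I] is the exact number of iterations still to come, which gives termination and
    the time bound together. *)
Lemma runs_while e c T (I : nat -> memory -> Prop) :
  (forall k s, I k.+1 s -> eval s e != 0 /\ runs c s T (I k)) ->
  (forall s, I 0 s -> eval s e = 0) ->
  forall k s, I k s -> runs (While e c) s (k.+1 * (ecost e + T).+1) (I 0).
Proof.
move=> stepI stopI; elim=> [|k IH] s Is.
  exists (ecost e).+1, s; split=> //; first exact/ExecWhileDone/stopI.
  by rewrite mul1n ltnS leq_addr.
have [e0 [t1 [s1 [e1 le1 I1]]]] := stepI _ _ Is.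
have [t2 [s2 [e2 le2 I2]]] := IH _ I1.
exists (ecost e + t1 + t2).+1, s2; split=> //; first exact: ExecWhileStep e1 e2.
by rewrite mulSn -addSn leq_add // ltnS leq_add2l.
Qed.

(** With the positive base [n.+1] powers grow with the exponent, so sums and products need no case
    for 0. *)
Lemma poly_boundedP (f : nat -> nat) :
  poly_bounded f <-> exists a d, forall n, f n <= a * n.+1 ^ d.
Proof.
have mono x y d : x <= y -> x ^ d <= y ^ d by case: d => // d; rewrite leq_exp2r.
split=> [[a [d h]]|[a [d h]]].
  exists (a + a), d => n; rewrite mulnDl (leq_trans (h n)) // leq_add //.
    by rewrite leq_mul2l mono ?orbT.
  by rewrite leq_pmulr // expn_gt0.
exists (a * 2 ^ d), d => n; apply: leq_trans (h n) _.
case: n => [|n].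
  by rewrite exp1n muln1 (leq_trans _ (leq_addl _ _)) // leq_pmulr // expn_gt0.
rewrite (leq_trans _ (leq_addr _ _)) // -mulnA leq_mul2l -expnMn mono ?orbT //.
by rewrite mul2n -addnn addSn addnS !ltnS leq_addl.
Qed.

Lemma poly_bounded_le (f g : nat -> nat) :
  (forall n, f n <= g n) -> poly_bounded g -> poly_bounded f.
Proof. by move=> fg [a [d h]]; exists a, d => n; apply: leq_trans (fg n) (h n). Qed.

Lemma poly_boundedC k : poly_bounded (fun=> k).
Proof. by apply/poly_boundedP; exists k, 0 => n; rewrite expn0 muln1. Qed.

Lemma poly_boundedS : poly_bounded succn.
Proof. by apply/poly_boundedP; exists 1, 1 => n; rewrite expn1 mul1n. Qed.

Lemma poly_boundedD (f g : nat -> nat) : poly_bounded f -> poly_bounded g ->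
  poly_bounded (fun n => f n + g n).
Proof.
move=> /poly_boundedP[a [d hf]] /poly_boundedP[a' [d' hg]].
apply/poly_boundedP; exists (a + a'), (d + d') => n; rewrite mulnDl.
apply: leq_add.
  by rewrite (leq_trans (hf n)) // expnD leq_mul2l leq_pmulr ?orbT // expn_gt0.
by rewrite (leq_trans (hg n)) // expnD leq_mul2l leq_pmull ?orbT // expn_gt0.
Qed.

Lemma poly_boundedM (f g : nat -> nat) : poly_bounded f -> poly_bounded g ->
  poly_bounded (fun n => f n * g n).
Proof.
move=> /poly_boundedP[a [d hf]] /poly_boundedP[a' [d' hg]].
apply/poly_boundedP; exists (a * a'), (d + d') => n.
by rewrite expnD mulnACA leq_mul.
Qed.

(* A language of for-loops over [0 .. m - 1], where a state is a family of
   infinite arrays; scalars are cells number [0].  The scalar [0] holds [m]. *)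
Definition state := nat -> nat -> nat.

Inductive lexp :=
  | Lit of nat
  | Cell of nat & lexp
  | LAdd of lexp & lexp
  | LSub of lexp & lexp.

Inductive prog :=
  | Put of nat & lexp & lexp
  | Then of prog & prog
  | When of lexp & prog
  | For of nat & prog.

Fixpoint leval (x : state) (e : lexp) : nat :=
  match e with
  | Lit n => n
  | Cell a i => x a (leval x i)
  | LAdd e1 e2 => leval x e1 + leval x e2
  | LSub e1 e2 => leval x e1 - leval x e2
  end.

Definition put (x : state) a i n : state :=
  fun a' i' => if (a' == a) && (i' == i) then n else x a' i'.

(* [For a p] behaves as a for-loop only if [p] does not assign [a]; this is
   part of the condition [pok] below. *)
Fixpoint den m (p : prog) (x : state) : state :=
  match p with
  | Put a i e => put x a (leval x i) (leval x e)
  | Then p1 p2 => den m p2 (den m p1 x)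
  | When e p1 => if leval x e != 0 then den m p1 x else x
  | For a p1 =>
      foldl (fun y k => put (den m p1 y) a 0 k.+1) (put x a 0 0) (iota 0 m)
  end.

Fixpoint writes (p : prog) : seq nat :=
  match p with
  | Put a _ _ => [:: a]
  | Then p1 p2 => writes p1 ++ writes p2
  | When _ p1 => writes p1
  | For a p1 => a :: writes p1
  end.

Lemma put_other (x : state) a i n a' j : a' != a -> put x a i n a' j = x a' j.
Proof. by rewrite /put => /negPf->. Qed.

Lemma put_same (x : state) a i n : put x a i n a i = n.
Proof. by rewrite /put !eqxx. Qed.

Lemma den_other m p x a i : a \notin writes p -> den m p x a i = x a i.
Proof.
elim: p x => [b k e|p IHp q IHq|e p IHp|b p IHp] x /=.
- by rewrite inE => /put_other.
- by rewrite mem_cat negb_or => /andP[/IHp h /IHq ->].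
- by case: ifP => // _ /IHp.
rewrite inE negb_or => /andP[ab /IHp h].
rewrite -[RHS](put_other x 0 0 i ab); elim: (iota 0 m) (put x b 0 0) => //= k s IH y.
by rewrite IH put_other.
Qed.

(** * Compilation of for-loop programs, with a cost bound *)

Section Compile.
Variable K : nat.

Fixpoint lok (e : lexp) : bool :=
  match e with
  | Lit _ => true
  | Cell a i => (a < K) && lok i
  | LAdd e1 e2 | LSub e1 e2 => lok e1 && lok e2
  end.

Fixpoint pok (p : prog) : bool :=
  match p with
  | Put a i e => [&& 0 < a, a < K, lok i & lok e]
  | Then p1 p2 => pok p1 && pok p2
  | When e p1 => lok e && pok p1
  | For a p1 => [&& 0 < a, a < K, a \notin writes p1 & pok p1]
  end.

(* Cell [i] of array [a] lives at address [B + a + K * i], where the frame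
   pointer [B] is kept in cell [0] of the memory. *)
Definition addr (a : nat) (i : expr) : expr :=
  Plus (Read (Const 0)) (Plus (Const a) (iter K (Plus i) (Const 0))).

Fixpoint cexp (e : lexp) : expr :=
  match e with
  | Lit n => Const n
  | Cell a i => Read (addr a (cexp i))
  | LAdd e1 e2 => Plus (cexp e1) (cexp e2)
  | LSub e1 e2 => Minus (cexp e1) (cexp e2)
  end.

Definition cput a i e := Store (addr a (cexp i)) (cexp e).

Fixpoint compile (p : prog) : cmd :=
  match p with
  | Put a i e => cput a i e
  | Then p1 p2 => Seq (compile p1) (compile p2)
  | When e p1 => If (cexp e) (compile p1) Skip
  | For a p1 => Seq (cput a (Lit 0) (Lit 0))
      (While (cexp (LSub (Cell 0 (Lit 0)) (Cell a (Lit 0))))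
         (Seq (compile p1) (cput a (Lit 0) (LAdd (Cell a (Lit 0)) (Lit 1)))))
  end.

Definition put_cost a i e := (ecost (addr a (cexp i)) + ecost (cexp e)).+1.

Fixpoint cost (p : prog) (m : nat) : nat :=
  match p with
  | Put a i e => put_cost a i e
  | Then p1 p2 => cost p1 m + cost p2 m
  | When e p1 => (ecost (cexp e) + (cost p1 m).+1).+1
  | For a p1 => put_cost a (Lit 0) (Lit 0) + m.+1 *
      (ecost (cexp (LSub (Cell 0 (Lit 0)) (Cell a (Lit 0)))) + (cost p1 m
        + put_cost a (Lit 0) (LAdd (Cell a (Lit 0)) (Lit 1)))).+1
  end.

Lemma cost_poly p : poly_bounded (cost p).
Proof.
elim: p => [a i e|p IHp q IHq|e p IHp|a p IHp].
- exact: poly_boundedC.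
- exact: poly_boundedD.
- apply: (@poly_bounded_le _ (fun m => (ecost (cexp e)).+2 + cost p m)).
    by move=> m /=; rewrite addnS.
  by apply: poly_boundedD IHp; apply: poly_boundedC.
apply: poly_boundedD; first exact: poly_boundedC.
apply: poly_boundedM; first exact: poly_boundedS.
set k := ecost _; apply: (@poly_bounded_le _ (fun m => k.+1 +
    (cost p m + put_cost a (Lit 0) (LAdd (Cell a (Lit 0)) (Lit 1))))) => [//|].
apply: poly_boundedD; first exact: poly_boundedC.
by apply: poly_boundedD IHp _; apply: poly_boundedC.
Qed.

Definition represents B (s : memory) (x : state) :=
  s 0 = B /\ forall a i, a < K -> s (B + (a + K * i)) = x a i.

Lemma eval_addr B s x a i : represents B s x ->
  eval s (addr a i) = B + (a + K * eval s i).
Proof.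
move=> [s0 _]; rewrite /= s0; congr (_ + (_ + _)).
by elim: K => // k IH; rewrite mulSn -IH.
Qed.

Lemma eval_cexp B s x e : represents B s x -> lok e -> eval s (cexp e) = leval x e.
Proof.
move=> sx; elim: e => //= [a i IH /andP[aK /IH E]|e IHe f IHf|e IHe f IHf].
- have := eval_addr a (cexp i) sx; rewrite /= => ->.
  by case: sx => _ /(_ _ _ aK) ->; rewrite E.
- by case/andP=> /IHe-> /IHf->.
- by case/andP=> /IHe-> /IHf->.
Qed.

Lemma addr_inj a a' i i' : a < K -> a' < K ->
  (a' + K * i' == a + K * i) = (a' == a) && (i' == i).
Proof.
move=> aK aK'; apply/eqP/andP => [E|[/eqP-> /eqP->//]].
have K0 : 0 < K by apply: leq_ltn_trans aK.
have Ei : i' = i.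
  have := congr1 (divn^~ K) E.
  by rewrite /= ![K * _]mulnC !divnDMl // !divn_small.
by move/eqP: E; rewrite Ei eqn_add2r.
Qed.

(** The postcondition also records that cells below the frame survive; the input and the output are
    kept there. *)
Lemma runs_put B s x a i e n (Q : memory -> Prop) : 0 < B -> represents B s x ->
  a < K -> lok i -> eval s e = n ->
  (forall s', represents B s' (put x a (leval x i) n) ->
    (forall z, z < B -> s' z = s z) -> Q s') ->
  runs (Store (addr a (cexp i)) e) s (ecost (addr a (cexp i)) + ecost e).+1 Q.
Proof.
move=> B0 sx aK oki se hQ; apply: runs_store.
rewrite (eval_addr _ _ sx) se (eval_cexp sx) //; apply: hQ => [|z zB] /=.
  split=> [|a' i' aK'] /=; first by case: eqP sx => [|_ []//]; lia.
  by rewrite eqn_add2l addr_inj // /put; case: ifP => // _; case: sx => _ ->.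
by case: eqP => //; lia.
Qed.

Lemma runs_cput B s x a i e (Q : memory -> Prop) : 0 < B -> represents B s x ->
  a < K -> lok i -> lok e ->
  (forall s', represents B s' (put x a (leval x i) (leval x e)) ->
    (forall z, z < B -> s' z = s z) -> Q s') ->
  runs (cput a i e) s (put_cost a i e) Q.
Proof. by move=> B0 sx aK oki oke; apply: runs_put; rewrite ?(eval_cexp sx). Qed.

Lemma foldl_iotaS (X : Type) (F : X -> nat -> X) x k :
  foldl F x (iota 0 k.+1) = F (foldl F x (iota 0 k)) k.
Proof. by rewrite -addn1 iotaD foldl_cat. Qed.

Lemma pok_writes0 p : pok p -> 0 \notin writes p.
Proof.
elim: p => [b i e|p1 IH1 p2 IH2|e p1 IH1|b p1 IH1] /=.
- by case/and4P; case: b.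
- by rewrite mem_cat negb_or => /andP[/IH1-> /IH2->].
- by case/andP=> _ /IH1.
- by case/and4P; case: b => // b _ _ _ /IH1.
Qed.

Lemma runs_compile B m p s x : 0 < B -> pok p -> represents B s x -> x 0 0 = m ->
  runs (compile p) s (cost p m) (fun s' => represents B s' (den m p x)).
Proof.
move=> B0; elim: p s x => [a i e|p IHp q IHq|e p IHp|a p IHp] s x /=.
- case/and4P=> a0 aK oki oke sx xm.
  by apply: (runs_cput B0 sx).
- case/andP=> okp okq sx xm; apply: runs_seq (IHp s x okp sx xm) _ => s1 s1x.
  by apply: IHq => //; rewrite den_other // pok_writes0.
- case/andP=> oke okp sx xm; apply: runs_if; rewrite (eval_cexp sx) //.
  case: ifP => _; last by exists 1, s; split; [apply: ExecSkip | |].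
  by apply: runs_weaken (IHp s x okp sx xm).
case/and4P=> a0 aK ap okp sx xm.
have K0 : 0 < K by apply: leq_ltn_trans aK.
pose F y k := put (den m p y) a 0 k.+1.
pose y k := foldl F (put x a 0 0) (iota 0 k).
have yS k : y k.+1 = put (den m p (y k)) a 0 k.+1 by rewrite /y foldl_iotaS.
(* The loop variable counts completed iterations and array 0 keeps [m], so the loop test [m - a]
   counts those remaining. *)
have ya k : y k a 0 = k by case: k => [|k]; [apply: put_same | rewrite yS put_same].
have ym k : y k 0 0 = m.
  have n0a : 0 != a by rewrite eq_sym -lt0n.
  elim: k => [|k IH]; first by rewrite /y /= put_other.
  by rewrite yS put_other // den_other // pok_writes0.
apply: (@runs_seq _ _ _ _ _ (fun s1 => represents B s1 (y 0))).
  by apply: (runs_cput B0 sx).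
move=> s1 s1y; pose I k s' := k <= m /\ represents B s' (y (m - k)).
have := @runs_while (cexp (LSub (Cell 0 (Lit 0)) (Cell a (Lit 0))))
  (Seq (compile p) (cput a (Lit 0) (LAdd (Cell a (Lit 0)) (Lit 1))))
  (cost p m + put_cost a (Lit 0) (LAdd (Cell a (Lit 0)) (Lit 1))) I.
move=> W; have {}W := W _ _ m s1; apply: runs_weaken (leqnn _) _ (W _ _ _).
- by move=> s' [_]; rewrite subn0.
- move=> k s' [km s'y]; rewrite (eval_cexp s'y) /= ?K0 ?aK // ym ya; split.
    by rewrite subKn.
  apply: runs_seq (IHp s' _ okp s'y (ym _)) _ => s2 s2y.
  apply: (runs_cput B0 s2y) => //=; rewrite ?aK // => s3 s3y _; split; first exact: ltnW.
  by rewrite -(subnSK km) yS; move: s3y; rewrite den_other // ya addn1.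
- by move=> s' [_ s'y]; rewrite (eval_cexp s'y) /= ?K0 ?aK // ym ya subn0 subnn.
- by split; rewrite ?subnn.
Qed.

End Compile.

(** * The algorithm as a for-loop program *)

Definition var a := Cell a (Lit 0).
(** Nonzero means true; truncated subtraction turns [1 - e] into the test for zero, from which the
    other connectives follow. *)
Definition lnot e := LSub (Lit 1) e.
Definition land e f := lnot (LAdd (lnot e) (lnot f)).
Definition lle e f := lnot (LSub e f).
Definition leqn e f := lnot (LAdd (LSub e f) (LSub f e)).
Definition triple e := LAdd e (LAdd e e).

Lemma leval_not x e : leval x (lnot e) = (leval x e == 0).
Proof. by rewrite /=; case: (leval x e) => //= n; lia. Qed.

Lemma leval_and x e f : leval x (land e f) = (leval x e != 0) && (leval x f != 0).
Proof. by rewrite leval_not /=; case: (leval x e) (leval x f) => [|n] [|k] //=; lia. Qed.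

Lemma leval_le x e f : leval x (lle e f) = (leval x e <= leval x f).
Proof. by rewrite leval_not. Qed.

Lemma leval_eqn x e f : leval x (leqn e f) = (leval x e == leval x f).
Proof. by rewrite leval_not /= addn_eq0 -eqn_leq. Qed.

Lemma leval_add x e f : leval x (LAdd e f) = leval x e + leval x f.
Proof. by []. Qed.

Lemma leval_triple x e : leval x (triple e) = 3 * leval x e.
Proof. by rewrite /=; lia. Qed.

(** If [view] ignores the loop variable, the loop acts on it as a fold. The body may assume that
    every array the loop does not write still has its initial content. *)
Lemma for_sim m a p (X : Type) (view : state -> X) (F : 'I_m -> X -> X) (x : state) :
  (forall y k, view (put y a 0 k) = view y) ->
  (forall (i : 'I_m) (y : state), (forall b j, b \notin a :: writes p -> y b j = x b j) ->
    y a 0 = i -> view (den m p y) = F i (view y)) ->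
  view (den m (For a p) x) = foldl (fun v i => F i v) (view x) (enum 'I_m).
Proof.
move=> view_put view_body; rewrite /= -val_enum_ord.
have {view_body} H : forall (s : seq 'I_m) k (y : state), map val s = iota k (size s) ->
    (forall b j, b \notin a :: writes p -> y b j = x b j) -> y a 0 = k ->
  view (foldl (fun y k => put (den m p y) a 0 k.+1) y (map val s)) =
    foldl (fun v i => F i v) (view y) s.
  elim=> [//|i s IH] k y /= [ik sk] yx yk.
  rewrite (IH k.+1) //; last by rewrite put_same ik.
    by rewrite view_put (view_body i) // yk.
  move=> b j ab; rewrite put_other; last by case/norP: ab.
  by rewrite den_other ?yx //; case/norP: ab.
rewrite -(view_put x 0) (H _ 0) ?put_same //; first by rewrite val_enum_ord size_enum_ord.
by move=> b j; rewrite inE => /norP[ab _]; rewrite put_other.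
Qed.

Definition tally w a e := Then (Put a (Lit 0) (Lit 0)) (For w (Put a (Lit 0) (LAdd (var a) e))).

Lemma foldl_addn (I : Type) (E : I -> nat) n s :
  foldl (fun k i => k + E i) n s = n + \sum_(i <- s) E i.
Proof.
elim: s n => [|i s IH] n /=; first by rewrite big_nil addn0.
by rewrite IH big_cons addnA.
Qed.

Lemma den_tally m w a e (x : state) (E : 'I_m -> nat) : a != w ->
  (forall (i : 'I_m) (y : state), (forall b j, b != a -> b != w -> y b j = x b j) ->
    y w 0 = i -> leval y e = E i) ->
  den m (tally w a e) x a 0 = \sum_i E i.
Proof.
move=> aw hE; have sim := @for_sim m w (Put a (Lit 0) (LAdd (var a) e)) _
  (fun y => y a 0) (fun i k => k + E i) (put x a 0 0).
rewrite [LHS]sim => [|y k|i y hy yw].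
- by rewrite foldl_addn put_same add0n big_enum.
- exact: put_other.
rewrite /= put_same; congr (_ + _); apply: hE yw => b j ba bw.
by rewrite hy ?put_other // !inE negb_or bw ba.
Qed.

(** Array 0 holds [m], and array 1 is left to the counter of the copying loops. *)
Definition mat_ := 2.
Definition row_ := 3.
Definition col_ := 4.
Definition out_ := 5.
Definition p1_ := 6.
Definition p2_ := 7.
Definition p3_ := 8.
Definition q1_ := 9.
Definition q2_ := 10.
Definition q3_ := 11.
Definition round_ := 12.
Definition p_ := 13.
Definition q_ := 14.
Definition r_ := 15.
Definition w_ := 16.
Definition npq := 17.
Definition npr := 18.
Definition nqr := 19.
Definition npqr := 20.
Definition nq := 21.
Definition nr := 22.
Definition bad_ := 23.
Definition width := 24.

Definition edge a b := Cell mat_ (LAdd (Cell row_ (var a)) (var b)).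
Definition colour a := Cell col_ (var a).

(** Row offsets [i * m] are tabulated by repeated addition, as there is no multiplication. *)
Definition init_rows := Then (Put row_ (Lit 0) (Lit 0))
  (For p_ (Put row_ (LAdd (var p_) (Lit 1)) (LAdd (Cell row_ (var p_)) (var 0)))).

Definition tallies :=
  Then (tally w_ npq (land (edge p_ w_) (edge q_ w_)))
  (Then (tally w_ npr (land (edge p_ w_) (edge r_ w_)))
  (Then (tally w_ nqr (land (edge q_ w_) (edge r_ w_)))
  (Then (tally w_ npqr (land (edge p_ w_) (land (edge q_ w_) (edge r_ w_))))
  (Then (tally w_ nq (edge q_ w_)) (tally w_ nr (edge r_ w_)))))).

Definition forces_test :=
  LAdd (land (edge p_ q_) (edge p_ r_))
      (land (var nq) (land (var nr)
        (land (lle (var nq) (triple (var npq))) (land (lle (var nr) (triple (var npr)))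
        (land (lle (var nq) (triple (var nqr))) (land (lle (var nr) (triple (var nqr)))
        (lnot (var npqr)))))))).

Definition step_prog :=
  When (land (lnot (colour p_)) (land (colour q_) (land (colour r_)
          (lnot (leqn (colour q_) (colour r_))))))
    (Then tallies (When forces_test
       (Put col_ (var p_) (LAdd (LSub (LSub (Lit 5) (colour q_)) (colour r_)) (Lit 1))))).

Definition sweep_prog := For p_ (For q_ (For r_ step_prog)).
Definition propagate_prog := For round_ sweep_prog.

Definition seed_prog :=
  Then (For p_ (Put col_ (var p_) (Lit 0)))
  (Then (Put col_ (var p1_) (Lit 1)) (Then (Put col_ (var p2_) (Lit 2))
  (Then (Put col_ (var p3_) (Lit 3)) (Then (Put col_ (var q1_) (Lit 1))
  (Then (Put col_ (var q2_) (Lit 2)) (Put col_ (var q3_) (Lit 3))))))).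

Definition check_prog :=
  Then (Put bad_ (Lit 0) (Lit 0))
    (For p_ (For q_ (Put bad_ (Lit 0) (LAdd (var bad_)
      (land (edge p_ q_) (land (colour p_)
        (lnot (land (colour q_) (lnot (leqn (colour p_) (colour q_))))))))))).

Definition commit_prog := When (lnot (var bad_))
  (For p_ (When (colour p_) (Put out_ (var p_) (LSub (colour p_) (Lit 1))))).

Definition attempt_prog :=
  Then seed_prog (Then propagate_prog (Then check_prog commit_prog)).

Definition solve_prog := Then init_rows
  (For p1_ (For p2_ (For p3_ (For q1_ (For q2_ (For q3_ attempt_prog)))))).

Lemma den_then m p p' x : den m (Then p p') x = den m p' (den m p x).
Proof. by []. Qed.

Lemma den_when m e p x : den m (When e p) x = if leval x e != 0 then den m p x else x.
Proof. by []. Qed.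

Lemma den_put m a i e x : den m (Put a i e) x = put x a (leval x i) (leval x e).
Proof. by []. Qed.

(** * The for-loop program computes [solve] *)

Section Simulation.
Variables (m : nat) (H : sgraph 'I_m).

Definition stores_graph (x : state) :=
  forall i j : 'I_m, x mat_ (x row_ i + j) = H i j.

Definition view a (x : state) : {ffun 'I_m -> nat} := [ffun i : 'I_m => x a i].

Lemma view_put a x (i : 'I_m) n : view a (put x a i n) = assign (view a x) i n.
Proof. by apply/ffunP=> j; rewrite !ffunE /put eqxx. Qed.

Lemma view_other a x y : (forall i, x a i = y a i) -> view a x = view a y.
Proof. by move=> xy; apply/ffunP=> i; rewrite !ffunE. Qed.

Lemma stores_graph_agree x y : (forall i, y mat_ i = x mat_ i) ->
  (forall i, y row_ i = x row_ i) -> stores_graph x -> stores_graph y.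
Proof. by move=> hm hr hx i j; rewrite hm hr. Qed.

Lemma leval_edge (x : state) a b (i j : 'I_m) : stores_graph x -> x a 0 = i -> x b 0 = j ->
  leval x (edge a b) = H i j.
Proof. by move=> hx xa xb; rewrite /= xa xb. Qed.

Lemma sum_mem (B : {pred 'I_m}) : \sum_i (i \in B : nat) = #|B|.
Proof. by rewrite -sum1_card [RHS]big_mkcond; apply: eq_bigr => i _; case: (i \in B). Qed.

Section Step.
Variables (p q r : 'I_m).

Definition at_pqr (x : state) :=
  [/\ stores_graph x, x p_ 0 = p, x q_ 0 = q & x r_ 0 = r].

Lemma at_pqr_agree x y : (forall b i, b \in [:: mat_; row_; p_; q_; r_] -> y b i = x b i) ->
  at_pqr x -> at_pqr y.
Proof.
move=> yx [hx xp xq xr]; split; try by rewrite yx.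
by apply: stores_graph_agree hx => i; rewrite yx.
Qed.

(** A finite check by evaluation: the list [[:: a; w_; a]] is what a tally writes. *)
Lemma at_pqr_fresh a b : a \in [:: npq; npr; nqr; npqr; nq; nr] ->
  b \in [:: mat_; row_; p_; q_; r_] -> (a != w_) && (b \notin [:: a; w_; a]).
Proof.
move=> ha hb; suff /allP/(_ a ha)/allP/(_ b hb) : all (fun a => all (fun b =>
  (a != w_) && (b \notin [:: a; w_; a])) [:: mat_; row_; p_; q_; r_])
  [:: npq; npr; nqr; npqr; nq; nr] by [].
by [].
Qed.

Lemma at_pqr_tally a e x : a \in [:: npq; npr; nqr; npqr; nq; nr] ->
  at_pqr x -> at_pqr (den m (tally w_ a e) x).
Proof.
move=> ha; apply: at_pqr_agree => b i hb; rewrite den_other //.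
by case/andP: (at_pqr_fresh ha hb).
Qed.

Lemma at_pqr_tallied a e (x : state) (E : {pred 'I_m}) :
  a \in [:: npq; npr; nqr; npqr; nq; nr] -> at_pqr x ->
  (forall (w : 'I_m) (y : state), at_pqr y -> y w_ 0 = w ->
    leval y e = (w \in E)) ->
  den m (tally w_ a e) x a 0 = #|E|.
Proof.
move=> ha hx he; rewrite -sum_mem; apply: den_tally.
  by have /andP[] := at_pqr_fresh ha (mem_head mat_ _).
move=> w y yx yw; apply: he yw; apply: at_pqr_agree hx => b i hb.
have /andP[_] := at_pqr_fresh ha hb; rewrite !inE !negb_or => /and3P[ba bw _].
exact: yx.
Qed.

Lemma tallies_forces x : at_pqr x ->
  (leval (den m tallies x) forces_test != 0) = forces H p q r.
Proof.
move=> hx.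
pose x1 := den m (tally w_ npq (land (edge p_ w_) (edge q_ w_))) x.
pose x2 := den m (tally w_ npr (land (edge p_ w_) (edge r_ w_))) x1.
pose x3 := den m (tally w_ nqr (land (edge q_ w_) (edge r_ w_))) x2.
pose x4 := den m (tally w_ npqr (land (edge p_ w_) (land (edge q_ w_) (edge r_ w_)))) x3.
pose x5 := den m (tally w_ nq (edge q_ w_)) x4.
pose x6 := den m (tally w_ nr (edge r_ w_)) x5.
have h1 : at_pqr x1 by apply: at_pqr_tally.
have h2 : at_pqr x2 by apply: at_pqr_tally.
have h3 : at_pqr x3 by apply: at_pqr_tally.
have h4 : at_pqr x4 by apply: at_pqr_tally.
have h5 : at_pqr x5 by apply: at_pqr_tally.
have h6 : at_pqr x6 by apply: at_pqr_tally.
have -> : den m tallies x = x6 by [].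
(* Each count is carried back through the later tallies, which write elsewhere, to the one that
   computes it. *)
have e1 : x6 npq 0 = codeg H p q.
  rewrite /x6 den_other // /x5 den_other // /x4 den_other // /x3 den_other //.
  rewrite /x2 den_other //; apply: at_pqr_tallied => // w y [hy yp yq yr] yw.
  by rewrite leval_and !(leval_edge hy yp yw) !(leval_edge hy yq yw) !inE !eqb0 !negbK.
have e2 : x6 npr 0 = codeg H p r.
  rewrite /x6 den_other // /x5 den_other // /x4 den_other // /x3 den_other //.
  apply: at_pqr_tallied => // w y [hy yp yq yr] yw.
  by rewrite leval_and !(leval_edge hy yp yw) !(leval_edge hy yr yw) !inE !eqb0 !negbK.
have e3 : x6 nqr 0 = codeg H q r.
  rewrite /x6 den_other // /x5 den_other // /x4 den_other //.
  apply: at_pqr_tallied => // w y [hy yp yq yr] yw.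
  by rewrite leval_and !(leval_edge hy yq yw) !(leval_edge hy yr yw) !inE !eqb0 !negbK.
have e4 : x6 npqr 0 = #|nbhd H p :&: nbhd H q :&: nbhd H r|.
  rewrite /x6 den_other // /x5 den_other //.
  apply: at_pqr_tallied => // w y [hy yp yq yr] yw.
  rewrite leval_and leval_and (leval_edge hy yp yw) (leval_edge hy yq yw).
  by rewrite (leval_edge hy yr yw) !inE !eqb0 !negbK andbA.
have e5 : x6 nq 0 = #|nbhd H q|.
  rewrite /x6 den_other //; apply: at_pqr_tallied => // w y [hy yp yq yr] yw.
  by rewrite (leval_edge hy yq yw) inE.
have e6 : x6 nr 0 = #|nbhd H r|.
  apply: at_pqr_tallied => // w y [hy yp yq yr] yw.
  by rewrite (leval_edge hy yr yw) inE.
have v a : leval x6 (var a) = x6 a 0 by [].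
have [hy yp yq yr] := h6; rewrite /forces_test leval_add !leval_and !leval_le.
rewrite !leval_triple leval_not !v e1 e2 e3 e4 e5 e6.
rewrite (leval_edge hy yp yq) (leval_edge hy yp yr).
by rewrite addn_eq0 !eqb0 negb_and !negbK -!lt0n.
Qed.

Lemma leval_colour (x : state) a (i : 'I_m) : x a 0 = i ->
  leval x (colour a) = view col_ x i.
Proof. by move=> xa; rewrite ffunE /= xa. Qed.

Lemma view_step x : at_pqr x ->
  view col_ (den m step_prog x) = step H p q r (view col_ x).
Proof.
move=> hx; have [_ xp xq xr] := hx; set f := view col_ x.
rewrite /step_prog den_when !leval_and leval_not leval_not leval_eqn.
rewrite (leval_colour xp) (leval_colour xq) (leval_colour xr) -/f !eqb0 !negbK.
have -> : step H p q r f = if [&& f p == 0, f q != 0, f r != 0 & f q != f r]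
    then if forces H p q r then assign f p (5 - f q - f r).+1 else f else f.
  by rewrite /step; do 4![case: (_ != _) || case: (_ == _)] => //=.
case: ifP => // _; rewrite den_then den_when tallies_forces //.
set y := den m tallies x.
have fy : view col_ y = f by apply: view_other => i; rewrite /y den_other.
have [_ yp yq yr] : at_pqr y.
  apply: at_pqr_agree hx => b i hb; rewrite /y den_other //; move: b hb.
  by apply/allP.
case: ifP => // _; rewrite -fy -(leval_colour yq) -(leval_colour yr) -view_put -yp.
by rewrite den_put /= addn1.
Qed.

End Step.
Lemma view_loop_var a b y k : b != a -> view b (put y a 0 k) = view b y.
Proof. by move=> ba; apply: view_other => i; rewrite put_other. Qed.

Lemma view_sweep x : stores_graph x ->
  view col_ (den m sweep_prog x) = sweep H (view col_ x).
Proof.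
move=> hx; apply: for_sim => [y k|p y1 hy1 y1p]; first exact: view_loop_var.
apply: for_sim => [y k|q y2 hy2 y2q]; first exact: view_loop_var.
apply: for_sim => [y k|r y3 hy3 y3r]; first exact: view_loop_var.
apply: view_step; split=> //.
- by apply: stores_graph_agree hx => i; rewrite hy3 // hy2 // hy1.
- by rewrite hy3 // hy2.
- by rewrite hy3.
Qed.

Lemma view_propagate x : stores_graph x ->
  view col_ (den m propagate_prog x) = propagate H (view col_ x).
Proof.
move=> hx; apply: for_sim => [y k|_ y hy _]; first exact: view_loop_var.
by apply: view_sweep; apply: stores_graph_agree hx => i; rewrite hy.
Qed.

Lemma view_seed (x : state) (p1 p2 p3 q1 q2 q3 : 'I_m) :
  x p1_ 0 = p1 -> x p2_ 0 = p2 -> x p3_ 0 = p3 ->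
  x q1_ 0 = q1 -> x q2_ 0 = q2 -> x q3_ 0 = q3 ->
  view col_ (den m seed_prog x) = seed p1 p2 p3 q1 q2 q3.
Proof.
move=> h1 h2 h3 h4 h5 h6; rewrite /seed_prog den_then /seed.
set y := den m _ x.
have -> : [ffun=> 0] = view col_ y :> {ffun _ -> _}.
  rewrite /y (for_sim (view := view col_) (F := fun i f => assign f i 0)).
  - rewrite (foldl_assign (fun _ _ => 0)) ?enum_uniq //.
    by apply/ffunP=> i; rewrite !ffunE mem_enum.
  - by move=> z k; apply: view_loop_var.
  - by move=> i z _ zi; rewrite den_put /= zi view_put.
have {}h1 : y p1_ 0 = p1 by rewrite /y den_other.
have {}h2 : y p2_ 0 = p2 by rewrite /y den_other.
have {}h3 : y p3_ 0 = p3 by rewrite /y den_other.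
have {}h4 : y q1_ 0 = q1 by rewrite /y den_other.
have {}h5 : y q2_ 0 = q2 by rewrite /y den_other.
have {}h6 : y q3_ 0 = q3 by rewrite /y den_other.
rewrite !den_then !den_put ![leval _ (Lit _)]/= ![leval _ (var _)]/=.
by rewrite !put_other // h1 h2 h3 h4 h5 h6 !view_put.
Qed.

(** [bad_] accumulates the number of violating pairs, and a sum of naturals vanishes only
    termwise. *)
Lemma check_consistent x : stores_graph x ->
  (den m check_prog x bad_ 0 == 0) = consistent H (view col_ x).
Proof.
move=> hx; set f := view col_ x.
pose e (p q : 'I_m) : nat :=
  H p q && ((f p != 0) && ~~ ((f q != 0) && (f p != f q))).
have -> : den m check_prog x bad_ 0 = \sum_p \sum_q e p q.
  rewrite /check_prog den_then; set x1 := den m _ x.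
  have x1x b i : b != bad_ -> x1 b i = x b i by move=> hb; rewrite /x1 /= put_other.
  have := @for_sim m p_ (For q_ _) _ (fun y => y bad_ 0)
    (fun p k => k + \sum_q e p q) x1.
  rewrite foldl_addn big_enum => ->; [|move=> z k|move=> p y hy yp].
  - by rewrite /x1 den_put put_same.
  - by rewrite put_other.
  have := @for_sim m q_ (Put bad_ _ _) _ (fun y => y bad_ 0) (fun q k => k + e p q) y.
  rewrite foldl_addn big_enum => ->; [by []|by move=> z k; rewrite put_other|].
  move=> q z hz zq; rewrite den_put put_same leval_add; congr (_ + _).
  have hz' b i : b \notin [:: p_; q_; bad_] -> z b i = x b i.
    rewrite !inE !negb_or => /and3P[bp bq bb].
    by rewrite hz ?hy ?x1x // !inE !negb_or ?bp ?bq ?bb.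
  have fz : view col_ z = f by apply: view_other => i; rewrite hz'.
  have zp : z p_ 0 = p by rewrite hz.
  rewrite leval_and leval_and leval_not leval_and leval_not leval_eqn.
  rewrite (@leval_edge z p_ q_ p q) //; last first.
    by apply: stores_graph_agree hx => i; rewrite hz'.
  by rewrite (leval_colour zp) (leval_colour zq) fz !eqb0 !negbK.
rewrite sum_nat_eq0; apply: eq_forallb => p; rewrite implyTb sum_nat_eq0.
apply: eq_forallb => q; rewrite implyTb /e eqb0.
by case: (H p q); case: (f p == 0); case: (f q == 0); case: (f p == f q).
Qed.

Lemma view_commit x : (x bad_ 0 == 0) = consistent H (view col_ x) ->
  view out_ (den m commit_prog x) = commit H (view col_ x) (view out_ x).
Proof.
move=> hbad; rewrite /commit_prog den_when leval_not eqb0 negbK hbad /commit.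
case: ifP => // _; set f := view col_ x.
rewrite (for_sim (view := view out_)
  (F := fun p o => assign o p (if f p != 0 then (f p).-1 else o p))).
- rewrite (foldl_assign (fun p n => if f p != 0 then (f p).-1 else n)) ?enum_uniq //.
  by apply/ffunP=> p; rewrite !ffunE mem_enum.
- by move=> z k; apply: view_loop_var.
move=> p z hz zp; rewrite den_when (leval_colour zp).
have -> : view col_ z = f by apply: view_other => i; rewrite hz.
case: ifP => fp; last first.
  by apply/ffunP=> q; rewrite !ffunE; case: eqP => [->|].
rewrite den_put [leval _ (var _)]/= zp view_put [leval _ (LSub _ _)]/= zp.
by rewrite hz // /f ffunE subn1.
Qed.

Lemma view_attempt (x : state) (p1 p2 p3 q1 q2 q3 : 'I_m) : stores_graph x ->
  x p1_ 0 = p1 -> x p2_ 0 = p2 -> x p3_ 0 = p3 ->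
  x q1_ 0 = q1 -> x q2_ 0 = q2 -> x q3_ 0 = q3 ->
  view out_ (den m attempt_prog x) =
    commit H (propagate H (seed p1 p2 p3 q1 q2 q3)) (view out_ x).
Proof.
move=> hx h1 h2 h3 h4 h5 h6; rewrite /attempt_prog !den_then.
set x1 := den m seed_prog x; set x2 := den m propagate_prog x1.
set x3 := den m check_prog x2.
have hx1 : stores_graph x1 by apply: stores_graph_agree hx => i; rewrite /x1 den_other.
have hx2 : stores_graph x2 by apply: stores_graph_agree hx1 => i; rewrite /x2 den_other.
have c3 : view col_ x3 = view col_ x2 by apply: view_other => i; rewrite /x3 den_other.
have o3 : view out_ x3 = view out_ x.
  by apply: view_other => i; rewrite /x3 den_other // /x2 den_other // /x1 den_other.
rewrite view_commit c3; last exact: check_consistent.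
by rewrite o3 view_propagate // (view_seed h1 h2 h3 h4 h5 h6).
Qed.

Lemma init_rows_graph x : x 0 0 = m ->
  (forall i j : 'I_m, x mat_ (i * m + j) = H i j) ->
  stores_graph (den m init_rows x).
Proof.
move=> xm xH i j; set y := den m init_rows x.
have -> : y mat_ (y row_ i + j) = x mat_ (y row_ i + j) by rewrite /y den_other.
suff -> : y row_ i = i * m by [].
rewrite /y /init_rows den_then; set x1 := den m _ x => {y}.
pose F (y : state) k := put (den m (Put row_ (LAdd (var p_) (Lit 1))
  (LAdd (Cell row_ (var p_)) (var 0))) y) p_ 0 k.+1.
suff h k : let y := foldl F (put x1 p_ 0 0) (iota 0 k) in
    [/\ y 0 0 = m, y p_ 0 = k & forall l, l <= k -> y row_ l = l * m].
  by have [_ _] := h m; apply; apply: ltnW.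
elim: k => [|k]; first by split=> // -[].
rewrite foldl_iotaS; set y := foldl _ _ _ => -[ym yk yrow]; split=> // l lk.
rewrite /F put_other // den_put [leval _ (LAdd (var _) _)]/= yk /put eqxx /= addn1.
case: eqP => [->|lk']; last by apply: yrow; move: lk lk'; lia.
by rewrite /= yk ym yrow // mulSn addnC.
Qed.

Lemma view_solve x : x 0 0 = m -> (forall i j : 'I_m, x mat_ (i * m + j) = H i j) ->
  (forall i, x out_ i = 0) -> view out_ (den m solve_prog x) = solve H.
Proof.
move=> xm xH x0; rewrite /solve_prog den_then; have := init_rows_graph xm xH.
set x1 := den m init_rows x => hx.
have -> : solve H = foldl (fun o p1 => foldl (fun o p2 => foldl (fun o p3 =>
    foldl (fun o q1 => foldl (fun o q2 => foldl (fun o q3 =>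
    commit H (propagate H (seed p1 p2 p3 q1 q2 q3)) o)
  o (enum 'I_m)) o (enum 'I_m)) o (enum 'I_m)) o (enum 'I_m)) o (enum 'I_m))
  (view out_ x1) (enum 'I_m).
  by congr foldl; apply/ffunP=> i; rewrite !ffunE /x1 den_other.
apply: for_sim => [y k|p1 y1 e1 h1]; first exact: view_loop_var.
apply: for_sim => [y k|p2 y2 e2 h2]; first exact: view_loop_var.
apply: for_sim => [y k|p3 y3 e3 h3]; first exact: view_loop_var.
apply: for_sim => [y k|q1 y4 e4 h4]; first exact: view_loop_var.
apply: for_sim => [y k|q2 y5 e5 h5]; first exact: view_loop_var.
apply: for_sim => [y k|q3 y6 e6 h6]; first exact: view_loop_var.
apply: view_attempt h6.
- by apply: stores_graph_agree hx => i; rewrite e6 // e5 // e4 // e3 // e2 // e1.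
- by rewrite e6 // e5 // e4 // e3 // e2.
- by rewrite e6 // e5 // e4 // e3.
- by rewrite e6 // e5 // e4.
- by rewrite e6 // e5.
- by rewrite e6.
Qed.

End Simulation.

Lemma solve_prog_ok : pok width solve_prog.
Proof. by []. Qed.

(** * The random access machine program *)

Section GraphMemory.
Variables (m : nat) (H : sgraph 'I_m).

(** Matrix positions are injective by [addr_inj] with [m] as the width. *)
Lemma graph_mem_edge (i j : 'I_m) : graph_mem H (i * m + j).+1 = H i j.
Proof.
rewrite /graph_mem /=; congr (nat_of_bool _).
apply/existsP/idP => [[i' /existsP[j' /andP[ij']]]|ij].
  rewrite eqSS addnC [_ + j']addnC ![_ * m]mulnC addr_inj // => /andP[/eqP ej /eqP ei].
  by rewrite (val_inj ei) (val_inj ej).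
by exists i; apply/existsP; exists j; rewrite ij eqxx.
Qed.

Lemma graph_mem_diag k : k < m -> graph_mem H (k * m + k).+1 = 0.
Proof. by move=> km; have := graph_mem_edge (Ordinal km) (Ordinal km); rewrite adj_irr. Qed.

Lemma graph_mem_large z : m * m < z -> graph_mem H z = 0.
Proof.
case: z => // z mz; rewrite /graph_mem /=; apply/eqP; rewrite eqb0.
apply/existsP => -[i /existsP[j /andP[_ /eqP[E]]]].
have := leq_mul (ltn_ord i) (leqnn m); have := ltn_ord j.
by move: mz; rewrite E mulSn; lia.
Qed.

(* Cells [1] and [m + 2] hold the diagonal entries [(0, 0)] and [(1, 1)], or
   lie beyond the matrix; both can therefore serve as scratch memory. *)
Lemma graph_mem1 : graph_mem H 1 = 0.
Proof.
have [m0|m0] := posnP m; first by apply: graph_mem_large; rewrite m0.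
exact: graph_mem_diag m0.
Qed.

Lemma graph_mem_m2 : graph_mem H (m + 2) = 0.
Proof.
have [m1|m1] := leqP m 1; first by apply: graph_mem_large; nia.
by have := graph_mem_diag m1; rewrite mul1n addn2 addn1.
Qed.

End GraphMemory.

(** * Setting up the frame, copying the input and writing the output *)

Definition scratch := Plus (Read (Const 0)) (Const 2).
Definition frame := Plus (Read scratch) (Plus (Read (Const 0)) (Const 3)).
(** This address lies beyond the matrix, the scratch cell [m + 2] and all output cells. *)
Definition frame_of m := m * m + (m + 3).

Definition square_body :=
  Seq (Store scratch (Plus (Read scratch) (Read (Const 0))))
      (Store (Const 1) (Minus (Read (Const 1)) (Const 1))).

Definition square_cmd :=
  Seq (Store (Const 1) (Read (Const 0))) (While (Read (Const 1)) square_body).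

Definition counter := 1.

(** The order matters: [frame] reads cell 0 and the scratch cell, so its value is saved in cell 1
    before these are overwritten. *)
Definition frame_cmd :=
  Seq (Store frame (Read (Const 0)))
  (Seq (Store (Plus frame (Const counter)) (Read scratch))
  (Seq (Store (Const 1) frame)
  (Seq (Store scratch (Const 0))
  (Seq (Store (Const 0) (Read (Const 1)))
       (Store (Const 1) (Const 0)))))).

Local Notation expr_of := (cexp width).
Local Notation put_at := (cput width).
Local Notation addr_of := (addr width).

Definition decrement := put_at counter (Lit 0) (LSub (var counter) (Lit 1)).

Definition copy_cmd := While (expr_of (var counter)) (Seq decrement
  (Store (addr_of mat_ (expr_of (var counter)))
         (Read (Plus (expr_of (var counter)) (Const 1))))).

Definition copy_cost := (ecost (expr_of (var counter)) +
  (put_cost width counter (Lit 0) (LSub (var counter) (Lit 1)) +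
   (ecost (addr_of mat_ (expr_of (var counter))) +
    ecost (Read (Plus (expr_of (var counter)) (Const 1)))).+1)).+1.

(** Cell 0 holds the frame pointer needed to read [out_], so it is written last. The loop descends
    from [m] to 1; cell [m] belongs to no vertex. *)
Definition output_cmd :=
  Seq (put_at counter (Lit 0) (var 0))
  (Seq (While (expr_of (var counter))
         (Seq (Store (expr_of (var counter)) (expr_of (Cell out_ (var counter)))) decrement))
       (Store (Const 0) (expr_of (Cell out_ (Lit 0))))).

Definition output_cost := (ecost (expr_of (var counter)) +
  ((ecost (expr_of (var counter)) + ecost (expr_of (Cell out_ (var counter)))).+1 +
   put_cost width counter (Lit 0) (LSub (var counter) (Lit 1)))).+1.

Definition colouring_cmd :=
  Seq square_cmd (Seq frame_cmd (Seq copy_cmd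
    (Seq (compile width solve_prog) output_cmd))).

Section Run.
Variables (m : nat) (H : sgraph 'I_m).
Notation g := (graph_mem H).
Notation B := (frame_of m).

Lemma runs_square : runs square_cmd g (4 + m.+1 * 22) (fun s => forall z,
    s z = if z == m + 2 then m * m else g z).
Proof.
pose I k (s : memory) := k <= m /\ forall z, s z =
  if z == 1 then k else if z == m + 2 then (m - k) * m else g z.
apply: runs_store_seq; set s1 := fun_of_simpl _.
apply: runs_weaken (leqnn _) _
  (@runs_while (Read (Const 1)) square_body 19 I _ _ m s1 _).
- move=> s [_ hs] z; rewrite hs subn0.
  by case: eqP => // ->; rewrite addn2 graph_mem1.
- move=> k s [km hs]; split; first by rewrite /= hs.
  have s0 : s 0 = m by rewrite hs addn2.
  have s2 : s (m + 2) = (m - k.+1) * m by rewrite hs eqxx addn2.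
  (* The costs of the two stores in [square_body]. *)
  have -> : 19 = 13 + 6 by [].
  apply: runs_store_seq; apply: runs_store; split; first exact: ltnW.
  move=> z /=; rewrite s0 s2 !hs /= addn2 /=.
  case: (z == 1); first by rewrite subn1.
  by case: (z == m.+2); rewrite // -(subnSK km) mulSn addnC.
- by move=> s [_ hs]; rewrite /= hs.
split=> // z; rewrite /s1 /= subnn mul0n.
by case: (z == 1) => //; case: eqP => // ->; rewrite graph_mem_m2.
Qed.

Definition framed k (s : memory) := forall z, s z =
  if z == 0 then B else if z == B then m else if z == B + counter then k else g z.

Lemma runs_frame s : (forall z, s z = if z == m + 2 then m * m else g z) ->
  runs frame_cmd s 100 (framed (m * m)).
Proof.
move=> hs.
have s0 : s 0 = m by rewrite hs addn2.
have s1 : s 1 = 0 by rewrite hs addn2 /= graph_mem1.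
have s2 : s (m + 2) = m * m by rewrite hs eqxx.
have lt : m + 2 < B by rewrite /frame_of; lia.
(* The costs of the six stores in order; their sum 56 is below 100. *)
apply: (@runs_weaken _ _ (13 + (18 + (12 + (6 + (4 + 3))))) _ (framed (m * m))) => //.
apply: runs_store_seq; rewrite /= s0 s2 -/(frame_of m).
pose t1 : memory := [eta s with B |-> m].
have [t10 t12] : t1 0 = m /\ t1 (m + 2) = m * m.
  by rewrite /t1 /= s0 s2; do ![case: eqP => //]; lia.
apply: (@runs_store_seq _ _ _ t1); rewrite /= t10 t12 -/(frame_of m) /counter.
pose t2 : memory := [eta t1 with B + 1 |-> m * m].
have [t20 t22] : t2 0 = m /\ t2 (m + 2) = m * m.
  by rewrite /t2 /= t10 t12; do ![case: eqP => //]; lia.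
apply: (@runs_store_seq _ _ _ t2); rewrite /= t20 t22 -/(frame_of m).
pose t3 : memory := [eta t2 with 1 |-> B].
have t30 : t3 0 = m by [].
apply: (@runs_store_seq _ _ _ t3); rewrite /= t30.
pose t4 : memory := [eta t3 with m + 2 |-> 0].
have t41 : t4 1 = B by rewrite /t4 /= addn2.
apply: (@runs_store_seq _ _ _ t4); rewrite /= t41.
pose t5 : memory := [eta t4 with 0 |-> B].
apply: (@runs_store _ _ t5) => z; rewrite /t5 /t4 /t3 /t2 /t1 /counter /=.
have [->|z1] := eqVneq z 1.
  by rewrite graph_mem1; do ![case: eqP => //]; lia.
have [//|z0] := eqVneq z 0.
have [->|z2] := eqVneq z (m + 2).
  by rewrite graph_mem_m2; do ![case: eqP => //]; lia.
have [->|zB1] := eqVneq z (B + 1); first by case: eqP => //; lia.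
by have [//|zB] := eqVneq z B; rewrite hs (negPf z2).
Qed.

Definition copied k : state := fun a i =>
  if (a == 0) && (i == 0) then m
  else if (a == counter) && (i == 0) then k
  else if (a == mat_) && (k <= i < m * m) then g i.+1 else 0.

(** Beyond the matrix the input memory is zero, so all other array cells start at 0. *)
Lemma framed_represents s : framed (m * m) s -> represents width B s (copied (m * m)).
Proof.
move=> hs; split=> [|a i aw]; first by rewrite hs.
have mB : m * m < B by rewrite /frame_of; lia.
have e k : k < width -> (a + width * i == k) = (a == k) && (i == 0).
  by move=> kw; rewrite -[k in LHS]addn0 -[0 in LHS](muln0 width) addr_inj.
rewrite hs eqn_add2l addn_eq0 (_ : B + _ == B = (a + width * i == 0)); last first.
  by rewrite -[X in _ == X]addn0 eqn_add2l.
have -> : (B == 0) = false by apply/eqP; lia.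
rewrite !e // /copied; do 2![case: ifP => // _].
rewrite graph_mem_large; first by case: ifP => //; lia.
by rewrite (leq_trans mB) // leq_addr.
Qed.

Lemma runs_copy s : framed (m * m) s ->
  runs copy_cmd s ((m * m).+1 * copy_cost) (fun s' => represents width B s' (copied 0)).
Proof.
move=> hs; have B0 : 0 < B by rewrite /frame_of; lia.
(* Copying proceeds downwards; the last clause keeps the input readable. *)
pose I k s' := [/\ k <= m * m, represents width B s' (copied k) &
  forall z, 0 < z < B -> s' z = g z].
have I0 : I (m * m) s.
  split=> // [|z /andP[z0 zB]]; first exact: framed_represents.
  by rewrite hs; do ![case: eqP => //]; lia.
apply: runs_weaken (leqnn _) _ (runs_while (I := I) _ _ I0) => [s' []//|k s1|s1].
  move=> [km s1x low]; split; first by rewrite (eval_cexp s1x).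
  apply: (@runs_seq _ _ _ _ _ (fun s2 => represents width B s2
    (put (copied k.+1) counter 0 k) /\ forall z, 0 < z < B -> s2 z = g z)).
    apply: (runs_cput B0 s1x) => // s2; rewrite /= subn1 => s2x low2; split=> // z.
    by case/andP=> z0 zB; rewrite low2 // low // z0.
  move=> s2 [s2x low2]; have kB : k.+1 < B by rewrite /frame_of; lia.
  apply: (@runs_put _ _ _ _ mat_ (var counter) _ (g k.+1) _ B0 s2x) => //.
    by rewrite -[LHS]/(s2 (eval s2 (expr_of (var counter)) + 1)) (eval_cexp s2x) // addn1 low2.
  move=> s3 s3x low3; split; first exact: ltnW.
    case: s3x => s30 s3x; split=> // a i aw; rewrite s3x // /put /copied /=.
    case: (a =P 0) => [->//|_]; case: (a =P counter) => [->|_] /=; first by case: eqP.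
    case: (a =P mat_) => //= _; case: (ltngtP k i) => //= <-.
    by rewrite km.
  by move=> z zB; rewrite low3 ?low2 //; case/andP: zB.
by move=> [_ s1x _]; rewrite (eval_cexp s1x).
Qed.

Lemma runs_output s x : x 0 0 = m -> represents width B s x ->
  runs output_cmd s (put_cost width counter (Lit 0) (var 0) + (m.+1 * output_cost
      + (ecost (Const 0) + ecost (expr_of (Cell out_ (Lit 0)))).+1))
    (fun s' => forall i, i <= m -> s' i = x out_ i).
Proof.
move=> xm sx; have mB : m < B by rewrite /frame_of; lia.
have B0 : 0 < B by apply: leq_ltn_trans mB.
pose I k s1 := [/\ k <= m, represents width B s1 (put x counter 0 k) &
  forall j, k < j <= m -> s1 j = x out_ j].
apply: (@runs_seq _ _ _ _ _ (I m)).
  apply: (runs_cput B0 sx) => // s1; rewrite /= xm => s1x _.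
  by split=> // j; rewrite ltnNge andNb.
move=> s1 I1; apply: runs_seq (runs_while (I := I) _ _ I1) _ => [k s2|s2|s2].
- move=> [km s2x low]; split; first by rewrite (eval_cexp s2x).
  apply: runs_store_seq; rewrite !(eval_cexp s2x) //= put_same put_other //.
  set s3 : memory := fun_of_simpl _.
  have s3x : represents width B s3 (put x counter 0 k.+1).
    have [s20 s2a] := s2x; split=> // a i aw; rewrite /s3 /= -s2a //.
    by case: eqP => // E; move: mB km; rewrite -E; lia.
  apply: (runs_cput B0 s3x) => // s4; rewrite /= subn1 => s4x low4.
  split; first exact: ltnW.
    case: s4x => s40 s4x; split=> // a i aw.
    by rewrite s4x // /put /=; case: ifP => // ->.
  move=> j /andP[kj jm]; rewrite low4 ?(leq_ltn_trans jm) // /s3 /=.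
  by case: eqP => [->//|jk]; apply: low; rewrite jm andbT ltn_neqAle kj eq_sym; apply/andP; split=> //; apply/eqP.
- by move=> [_ s2x _]; rewrite (eval_cexp s2x).
move=> [_ s2x low]; apply: runs_store => i im; rewrite (eval_cexp s2x) //= put_other //.
by case: eqP => [->//|i0]; apply: low; rewrite im andbT lt0n; apply/eqP.
Qed.

Lemma runs_colouring :
  runs colouring_cmd g (4 + m.+1 * 22 + (100 + ((m * m).+1 * copy_cost +
      (cost width solve_prog m + (put_cost width counter (Lit 0) (var 0) +
      (m.+1 * output_cost + (ecost (Const 0) + ecost (expr_of (Cell out_ (Lit 0)))).+1))))))
    (fun s => forall i : 'I_m, s i = solve H i).
Proof.
have B0 : 0 < B by rewrite /frame_of; lia.
apply: runs_seq runs_square _ => s1 s1x.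
apply: runs_seq (runs_frame s1x) _ => s2 s2x.
apply: runs_seq (runs_copy s2x) _ => s3 s3x.
apply: runs_seq (runs_compile B0 solve_prog_ok s3x (erefl _)) _ => s4 s4x.
have xm : den m solve_prog (copied 0) 0 0 = m by rewrite den_other.
apply: runs_weaken (leqnn _) _ (runs_output xm s4x) => s5 h i.
rewrite h; last exact: ltnW.
have <- : view m out_ (den m solve_prog (copied 0)) = solve H.
  apply: view_solve => // j k; rewrite /copied /= -graph_mem_edge.
  rewrite ifT //; have := leq_mul (ltn_ord j) (leqnn m); have := ltn_ord k.
  by rewrite mulSn; lia.
by rewrite ffunE.
Qed.

End Run.

Theorem theorem1p2 (R : realFieldType) (eps : R)
    (heps : (eps < 1 / 40%:R)%R) :
  exists A : cmd,
    poly_time A /\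
    exists2 T : nat -> nat, poly_bounded T &
      forall (n : nat) (V : finType) (G : sgraph V)
             (m : nat) (H : sgraph 'I_m),
        #|V| = n ->
        edge_expander (3%:R * eps)%R G ->
        near_K3_tensor eps G H ->
        exists (t : nat) (s : memory) (c : 'I_m -> 'I_3),
          [/\ exec A (graph_mem H) t s,
              t <= T n,
              outputs_coloring s c
            & proper_coloring H c].
Proof.
pose T m := 4 + m.+1 * 22 + (100 + ((m * m).+1 * copy_cost +
      (cost width solve_prog m + (put_cost width counter (Lit 0) (var 0) +
      (m.+1 * output_cost + (ecost (Const 0) + ecost (expr_of (Cell out_ (Lit 0)))).+1))))).
have T_poly : poly_bounded T.
  have polyC := poly_boundedC; have polyS := poly_boundedS.
  have polyI : poly_bounded id by apply: poly_bounded_le polyS => n; apply: leqnSn.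
  have polySS : poly_bounded (fun m => (m * m).+1).
    apply: (@poly_bounded_le _ (fun m => 1 + m * m)) => //.
    by apply: poly_boundedD; [apply: polyC | apply: poly_boundedM].
  have polyM := poly_boundedM.
  by rewrite /T; repeat first [exact: polyC | exact: polyS | exact: polySS
    | exact: cost_poly | apply: poly_boundedD | apply: polyM].
exists colouring_cmd; split.
  by exists T => // m H; have [t [s [e le _]]] := runs_colouring H; exists t, s.
(* [T] bounds the time in the number of vertices of [H], which is three times that of [G]. *)
exists (fun n => T (3 * n)).
  have /poly_boundedP[a [d h]] := T_poly.
  apply/poly_boundedP; exists (a * 3 ^ d), d => n; apply: leq_trans (h _) _.
  rewrite -mulnA leq_mul2l -expnMn; case: d {h} => [|d]; rewrite ?orbT //.
  by rewrite leq_exp2r //; apply/orP; right; lia.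
move=> n V G m H Vn expG [E' [E'P few [f [f_bij fH]]]].
have [t [s [e le out_]]] := runs_colouring H.
have mn : m = 3 * n.
  by have := bij_eq_card f_bij; rewrite card_ord card_prod card_ord Vn.
exists t, s, (fun i => Ordinal (solve_lt3 H i)); split=> //; first by rewrite -mn.
have [f' fK f'K] := f_bij.
move=> p q pq; rewrite -val_eqE /=.
pose mk (x : 'I_3) (v : V) := f' (x, v).
have adjH u w : H u w -> ((f u).1 != (f w).1) && G (f u).2 (f w).2.
  by rewrite fH /= /del_rel /= /tensor_rel => /andP[].
apply: (@solve_correct R eps heps V G _ H (fun i => (f i).1) (fun i => (f i).2) mk) => //.
- by move=> x v; rewrite /mk f'K.
- by move=> x v; rewrite /mk f'K.
- by move=> i; rewrite /mk -surjective_pairing fK.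
move=> i; have nbP : #|nbhd (tensor K3 G) (f i)| = 2 * #|nbhd G (f i).2|.
  have -> : nbhd (tensor K3 G) (f i) = setX [set~ (f i).1] (nbhd G (f i).2).
    by apply/setP=> -[x v]; rewrite !inE /= /tensor_rel /= eq_sym.
  by rewrite cardsX cardsC1 card_ord.
apply: le_trans (_ : _ <= #|[set e in E' | f i \in e]|%:R)%R _; last first.
  by rewrite -nbP; apply: few.
(* Deleted vertices at [i] inject into the edges of [E'] at [f i]. *)
rewrite ler_nat -(@card_in_imset _ _ (fun q => [set f i; f q])).
  apply/subset_leq_card/subsetP=> e' /imsetP[j]; rewrite !inE => /and3P[ci gi nij] ->.
  rewrite !inE eqxx andbT; apply: contraNT nij => nE.
  by rewrite fH /= /del_rel /= /tensor_rel /= ci gi.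
move=> j k; rewrite !inE => /and3P[cj _ _] /and3P[ck _ _] E.
have: f j \in [set f i; f k] by rewrite -E !inE eqxx orbT.
rewrite !inE => /orP[/eqP ji|/eqP/(bij_inj f_bij)//].
by rewrite ji eqxx in cj.
Qed.
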